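(* Let $1\le s<n-1$, $T=\{1,\dots,s\}$, $S=\{s+1,\dots,n\}$, and let $sl(n,\mathbb C)$ act on $\mathcal B=\mathbb C[x_1,\dots,x_n,y_1,\dots,y_n]$ by the representation attached to $(S,T)$ described in the context. Let $$\Delta=\sum_{j=s+1}^n\partial_{x_j}\partial_{y_j}-\sum_{i=1}^sx_i\partial_{y_i},\qquad\eta=\sum_{j=s+1}^nx_jy_j+\sum_{i=1}^sy_i\partial_{x_i},$$ and $\mathcal H_{l_1,l_2}=\{f\in\mathcal B_{l_1,l_2}\mid\Delta(f)=0\}$ for $l_1\in\mathbb Z$, $l_2\in\mathbb N$. If $l_1+l_2\le-(n-s-1)$ or $l_1>-(n-s-1)$, then $$\mathcal B_{l_1,l_2}=\mathcal H_{l_1,l_2}\oplus\eta\mathcal B_{l_1-1,l_2-1},$$ and $\mathcal H_{l_1,l_2}$ is an irreducible highest weight module with a basis consisting of the polynomials $$\sum_{r_1,\dots,r_{n-1}=0}^\infty\frac{(-1)^{r_{s+1}+\cdots+r_{n-1}}\,\alpha_n!\,\beta_n!\prod_{j=s+1}^{n-1}\binom{\alpha_j}{r_j}\prod_{i=1}^{n-1}\binom{\beta_i}{r_i}\,(r_1+\cdots+r_{n-1})!\prod_{j=s+1}^{n-1}r_j!}{(\alpha_n+r_1+\cdots+r_{n-1})!\,(\beta_n+r_1+\cdots+r_{n-1})!}$$ $$\times\prod_{i=1}^sx_i^{\alpha_i+r_i}\prod_{j=s+1}^{n-1}x_j^{\alpha_j-r_j}\prod_{i=1}^{n-1}y_i^{\beta_i-r_i}\;x_n^{\alpha_n+r_1+\cdots+r_{n-1}}y_n^{\beta_n+r_1+\cdots+r_{n-1}},$$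 where $\alpha_1,\dots,\alpha_n,\beta_1,\dots,\beta_n\in\mathbb N$, $\alpha_n\beta_n=0$, $\sum_{j=s+1}^n\alpha_j-\sum_{i=1}^s\alpha_i=l_1$ and $\sum_{i=1}^n\beta_i=l_2$. When $l_1+l_2\le-(n-s-1)$ or $-(n-s-1)<l_1\le0$, the highest weight of $\mathcal H_{l_1,l_2}$ is $-l_1\lambda_{s-1}+(l_1-1)\lambda_s+l_2\lambda_{n-1}$ and a corresponding highest weight vector is $x_s^{-l_1}y_n^{l_2}$; when $l_1>0$, the highest weight is $-(l_1+1)\lambda_s+l_1\lambda_{s+1}+l_2\lambda_{n-1}$ and a corresponding highest weight vector is $x_{s+1}^{l_1}y_n^{l_2}$.
   Context: $\mathbb N$ denotes the nonnegative integers; $E_{i,j}$ are matrix units of size $n$; $\binom ar=0$ for $r>a$. $sl(n,\mathbb C)$ has Cartan subalgebra $H=\sum_{i=1}^{n-1}\mathbb C(E_{i,i}-E_{i+1,i+1})$, positive root vectors $E_{i,j}$ ($1\le i<j\le n$) spanning $\mathcal G_+$, and fundamental weights $\lambda_i$ with $\lambda_i(E_{j,j}-E_{j+1,j+1})=\delta_{i,j}$; $\lambda_0=0$. For a partition $(S,T)$ of $\{1,\dots,n\}$, $sl(n,\mathbb C)$ acts on $\mathcal B$ by (the restriction of): $E_{i,j}=x_i\partial_{x_j}-y_j\partial_{y_i}$ if $i,j\in S$; $-x_ix_j-y_j\partial_{y_i}$ if $i\in S,j\in T$; $\partial_{x_i}\partial_{x_j}-y_j\partial_{y_i}$ if $i\in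 T,j\in S$; $-x_j\partial_{x_i}-\delta_{i,j}-y_j\partial_{y_i}$ if $i,j\in T$. $\mathcal B_{l_1,l_2}=\mathrm{Span}\{x^\alpha y^\beta\mid\sum_{i\in S}\alpha_i-\sum_{i\in T}\alpha_i=l_1,\ |\beta|=l_2\}$, which is $\{0\}$ for $l_2<0$. The operators $\Delta,\eta$ commute with $sl(n,\mathbb C)$. A highest weight module is one generated by a nonzero $v$ with $H.v\subset\mathbb Cv$ and $\mathcal G_+.v=0$ (a highest weight vector), whose weight is the highest weight. *)

(* Defs.v *)
From mathcomp Require Import all_boot all_order all_algebra.
From mathcomp Require Import mpoly.
Set Implicit Arguments.
Unset Strict Implicit.
Unset Printing Implicit Defensive.
Import GRing.Theory.
Local Open Scope ring_scope.

Section LinearAlgebra.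
Variables (K : fieldType) (V : lmodType K).

(* The spaces involved are infinite-dimensional, so subspaces are Prop-valued
   predicates rather than elements of {vspace V}. *)
Definition is_subspace (W : V -> Prop) : Prop :=
  W 0 /\ forall (a : K) (u v : V), W u -> W v -> W (a *: u + v).

Definition in_span (P : V -> Prop) (f : V) : Prop :=
  exists (k : nat) (c : 'I_k -> K) (g : 'I_k -> V),
    (forall i, P (g i)) /\ f = \sum_(i < k) c i *: g i.

Definition direct_sum (W U U' : V -> Prop) : Prop :=
  (forall f, W f <-> exists u u', [/\ U u, U' u' & f = u + u']) /\
  (forall f, U f -> U' f -> f = 0).

(* The family (e i), for i ranging over the indices satisfying P, is a basis
   of W; in particular distinct indices give distinct vectors. *)
Definition basis_family (I : eqType) (P : I -> Prop) (e : I -> V)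
    (W : V -> Prop) : Prop :=
  (forall f, W f <-> in_span (fun g => exists2 i, P i & g = e i) f) /\
  (forall (t : seq I) (c : I -> K),
     uniq t -> (forall i, i \in t -> P i) ->
     \sum_(i <- t) c i *: e i = 0 -> forall i, i \in t -> c i = 0).

End LinearAlgebra.

Section SpecialLinear.
Variables (K : fieldType) (n : nat).

Definition in_sl (A : 'M[K]_n) : Prop := \tr A = 0.

Definition in_cartan : 'M[K]_n -> Prop :=
  in_span (fun h => exists i j : 'I_n,
    j = i.+1 :> nat /\ h = delta_mx i i - delta_mx j j).

Definition in_Gplus : 'M[K]_n -> Prop :=
  in_span (fun A => exists i j : 'I_n, (i < j)%N /\ A = delta_mx i j).

(* The fundamental weight lambda_i, numbered from 1 as usual: it maps
   diag (h_1, ..., h_n) to h_1 + ... + h_i, and lambda_0 = 0. *)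
Definition fundwt (i : nat) (h : 'M[K]_n) : K := \sum_(k < n | (k < i)%N) h k k.

(* The 0-based ordinal j is the j.+1-st index, hence the shift in i == j.+1. *)
Lemma fundwtE (i : nat) (j j' : 'I_n) : j' = j.+1 :> nat ->
  fundwt i (delta_mx j j - delta_mx j' j') = (i == j.+1)%:R.
Proof.
have fwd (l : 'I_n) : fundwt i (delta_mx l l) = (l < i)%N%:R.
  rewrite /fundwt big_mkcond (bigD1 l) //= big1 => [|k /negPf nkl].
    by rewrite mxE !eqxx addr0; case: ifP.
  by rewrite mxE nkl; case: ifP.
move=> def_j'; transitivity (fundwt i (delta_mx j j) - fundwt i (delta_mx j' j')).
  by rewrite -sumrB; apply: eq_bigr => k _; rewrite !mxE.
by rewrite !fwd def_j'; case: (ltngtP i j.+1); rewrite ?subrr ?subr0.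
Qed.

Lemma fundwtD (i : nat) (a : K) (h h' : 'M[K]_n) :
  fundwt i (a *: h + h') = a * fundwt i h + fundwt i h'.
Proof.
by rewrite /fundwt mulr_sumr -big_split; apply: eq_bigr => k _; rewrite !mxE.
Qed.

End SpecialLinear.

(* Modules for sl(n): [act A] is the action of the matrix A, of which only the
   traceless matrices A are used. *)
Section Modules.
Variables (K : fieldType) (n : nat) (V : lmodType K).
Variable act : 'M[K]_n -> V -> V.

Definition is_submodule (W : V -> Prop) : Prop :=
  is_subspace W /\ forall A f, in_sl A -> W f -> W (act A f).

Definition irreducible_module (W : V -> Prop) : Prop :=
  [/\ is_submodule W,
      exists2 f, W f & f <> 0 &
      forall U : V -> Prop, is_submodule U -> (forall f, U f -> W f) ->
        (forall f, U f -> f = 0) \/ (forall f, W f -> U f)].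

Definition generated_by (W : V -> Prop) (v : V) : Prop :=
  [/\ is_submodule W, W v &
      forall U : V -> Prop, is_submodule U -> U v -> forall f, W f -> U f].

Definition highest_weight_vector (v : V) : Prop :=
  [/\ v <> 0,
      forall h, in_cartan h -> exists c : K, act h v = c *: v &
      forall A, in_Gplus A -> act A v = 0].

Definition has_weight (lam : 'M[K]_n -> K) (v : V) : Prop :=
  forall h, in_cartan h -> act h v = lam h *: v.

Definition highest_weight_module (W : V -> Prop) : Prop :=
  exists v, highest_weight_vector v /\ generated_by W v.

Definition has_highest_weight (W : V -> Prop) (lam : 'M[K]_n -> K) (v : V) :
    Prop :=
  [/\ highest_weight_vector v, generated_by W v & has_weight lam v].

End Modules.

(* The polynomial ring in x_1, ..., x_n, y_1, ..., y_n is {mpoly K[n + n]}: the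
   first n variables are the x's and the last n are the y's. *)
Section Oscillator.
Variables (K : fieldType) (n : nat).
Notation B := {mpoly K[n + n]}.

Definition xv (i : 'I_n) : B := 'X_(lshift n i).
Definition yv (i : 'I_n) : B := 'X_(rshift n i).
Definition dx (i : 'I_n) (f : B) : B := f^`M(lshift n i).
Definition dy (i : 'I_n) (f : B) : B := f^`M(rshift n i).

(* T is one block of the partition (S, T), and S is its complement. *)
Variable T : {set 'I_n}.

Definition Eact (i j : 'I_n) (f : B) : B :=
  match i \in T, j \in T with
  | false, false => xv i * dx j f
  | false, true => - (xv i * xv j * f)
  | true, false => dx i (dx j f)
  | true, true => - (xv j * dx i f) - (i == j)%:R *: f
  end - yv j * dy i f.

Definition osc_act (A : 'M[K]_n) (f : B) : B :=
  \sum_(i < n) \sum_(j < n) A i j *: Eact i j f.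

Definition Delta (f : B) : B :=
  \sum_(j < n | j \notin T) dx j (dy j f) - \sum_(i < n | i \in T) xv i * dy i f.

Definition eta (f : B) : B :=
  \sum_(j < n | j \notin T) xv j * yv j * f + \sum_(i < n | i \in T) yv i * dx i f.

Definition bidegree (l1 l2 : int) (a b : 'X_{1..n}) : Prop :=
  \sum_(j < n | j \notin T) (a j)%:Z - \sum_(i < n | i \in T) (a i)%:Z = l1 /\
  (mdeg b)%:Z = l2.

Definition xymon (a b : 'X_{1..n}) : B :=
  (\prod_(i < n) xv i ^+ a i) * (\prod_(i < n) yv i ^+ b i).

Definition Bsp (l1 l2 : int) : B -> Prop :=
  in_span (fun f => exists a b, bidegree l1 l2 a b /\ f = xymon a b).

Definition Hsp (l1 l2 : int) (f : B) : Prop := Bsp l1 l2 f /\ Delta f = 0.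

End Oscillator.

(* From here on n = m.+1, so that the multi-indices (r_1, ..., r_{n-1}) have
   type 'X_{1..m}, with mdeg r = r_1 + ... + r_{n-1}; [ord_max] is the last
   index n and [ix] embeds the indices 1, ..., n - 1. *)
Section HarmonicBasis.
Variables (K : fieldType) (m s : nat).
Notation B := {mpoly K[m.+1 + m.+1]}.

Definition Tset : {set 'I_m.+1} := [set i : 'I_m.+1 | (i < s)%N].

Definition ix (i : 'I_m) : 'I_m.+1 := widen_ord (leqnSn m) i.

Definition hterm_coef (a b : 'X_{1..m.+1}) (r : 'X_{1..m}) : K :=
  (-1) ^+ (\sum_(j < m | (s <= j)%N) r j)%N *
  ((a ord_max)`! * (b ord_max)`! *
   (\prod_(j < m | (s <= j)%N) 'C(a (ix j), r j)) *
   (\prod_(i < m) 'C(b (ix i), r i)) *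
   (mdeg r)`! * (\prod_(j < m | (s <= j)%N) (r j)`!))%N%:R /
  ((a ord_max + mdeg r)`! * (b ord_max + mdeg r)`!)%N%:R.

(* The truncated subtractions are harmless: when one of them truncates, a
   binomial coefficient of hterm_coef vanishes. *)
Definition hterm_mon (a b : 'X_{1..m.+1}) (r : 'X_{1..m}) : B :=
  (\prod_(i < m | (i < s)%N) xv K (ix i) ^+ (a (ix i) + r i)) *
  (\prod_(j < m | (s <= j)%N) xv K (ix j) ^+ (a (ix j) - r j)) *
  (\prod_(i < m) yv K (ix i) ^+ (b (ix i) - r i)) *
  xv K ord_max ^+ (a ord_max + mdeg r) *
  yv K ord_max ^+ (b ord_max + mdeg r).

(* The sum over all r in N^(n-1) is finite: by hterm_coef_eq0 the terms with
   mdeg r > mdeg b vanish. *)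
Definition hpoly (a b : 'X_{1..m.+1}) : B :=
  \sum_(r : 'X_{1..m < (mdeg b).+1}) hterm_coef a b r *: hterm_mon a b r.

Lemma hterm_coef_eq0 (a b : 'X_{1..m.+1}) (r : 'X_{1..m}) :
  (mdeg b < mdeg r)%N -> hterm_coef a b r = 0.
Proof.
move=> lt_br; have [i lt_bi]: exists i : 'I_m, (b (ix i) < r i)%N.
  apply/existsP; apply: contraLR lt_br => /existsPn le_rb.
  rewrite -leqNgt !mdegE big_ord_recr /=.
  apply: leq_trans (leq_addr _ _); apply: leq_sum => i _.
  by have := le_rb i; rewrite -leqNgt.
rewrite /hterm_coef.
have -> : (\prod_(k < m) 'C(b (ix k), r k) = 0)%N.
  by rewrite (bigD1 i) //= bin_small.
by rewrite muln0 !mul0n mulr0 mul0r.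
Qed.

Definition hindex (l1 l2 : int) (p : 'X_{1..m.+1} * 'X_{1..m.+1}) : Prop :=
  (p.1 ord_max * p.2 ord_max = 0)%N /\ bidegree Tset l1 l2 p.1 p.2.

End HarmonicBasis.

(* Main.v *)
(* Put P_k = d/dx_k, Q_k = x_k for k in S and P_k = - x_k, Q_k = d/dx_k for k in
   T. Then [P_k, Q_l] = delta_kl, E_ij = Q_i P_j - y_j d/dy_i,
   Delta = sum P_k d/dy_k and eta = sum Q_k y_k, uniformly in the partition, and
   [Delta, eta] acts on B_(l1,l2) by the scalar l1 + l2 + n - s. Hence
   Delta^k eta = eta Delta^k + c_k Delta^(k-1) with c_k <> 0 in the range needed,
   which gives the decomposition by induction on the order of nilpotency of Delta.

   The central fact is that a subspace of B_(l1,l2) stable under the E_ji, i < j,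
   and containing eta B_(l1-1,l2-1) and the highest weight monomial v is all of
   B_(l1,l2). It shows at once that v generates H modulo the image of eta, and,
   applied to an orthogonal complement for the contravariant form (for which E_ij
   and E_ji, as well as Delta and eta, are adjoint), that v is the only singular
   vector of H up to scalars. A nonzero submodule of H contains a singular vector,
   so H is irreducible.

   Since Delta = d/dx_n d/dy_n + (operators leaving the exponents of x_n and y_n
   alone), an element of H is determined by its coefficients at the monomials with
   alpha_n beta_n = 0, and the polynomials of the basis have exactly one of them. *)
From HB Require Import structures.
Require Import Defs.
From mathcomp Require Import all_boot all_order all_algebra.
From mathcomp Require Import mpoly complex reals ring zify.
Set Implicit Arguments.
Unset Strict Implicit.
Unset Printing Implicit Defensive.
Import Order.TTheory GRing.Theory Num.Theory.
Local Open Scope ring_scope.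

(** * Coefficients, derivatives and additive weights of monomials *)

Section Mpoly.
Variables (N : nat) (K : fieldType).
Implicit Types (f : {mpoly K[N]}) (q : 'X_{1..N}).

Lemma mcoeff_mulXU i f q :
  ('X_i * f)@_q = if q i == 0%N then 0 else f@_(q - U_(i)).
Proof.
case: ifPn => [/eqP qi0 | qi].
  apply: memN_msupp_eq0; apply/negP => /msuppM_le /allpairsP[[a b] /= []].
  rewrite msuppX inE => /eqP -> _ q_eq.
  by move: qi0; rewrite q_eq mnmDE mnm1E eqxx.
by rewrite -[in LHS](submK (m := U_(i)) (m' := q)) ?lep1mP // mulrC addmC mcoeffMX.
Qed.

Lemma mderiv_mulXU i j f :
  ('X_j * f)^`M(i) = 'X_j * f^`M(i) + (i == j)%:R *: f.
Proof.
rewrite mderivM addrC mderivX; congr (_ + _).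
rewrite mnm1E eq_sym; case: eqP => [->|_]; last by rewrite !scale0r mul0r.
rewrite !scale1r (_ : (U_(j) - U_(j) = 0)%MM) ?mpolyX0 ?mul1r //.
by apply/mnmP => k; rewrite mnmBE subnn mnm0E.
Qed.

Lemma mulXU_mderivE i f q : ('X_i * f^`M(i))@_q = (q i)%:R * f@_q.
Proof.
rewrite mcoeff_mulXU; case: eqP => [->|/eqP qi]; first by rewrite mul0r.
rewrite mcoeff_deriv submK ?lep1mP // mnmBE mnm1E eqxx subn1.
by rewrite prednK ?lt0n // mulr_natl.
Qed.

Lemma mulXU_mpolyX i q : 'X_i * 'X_[q] = 'X_[q + U_(i)] :> {mpoly K[N]}.
Proof. by rewrite addmC mpolyXD. Qed.

(* Additive functionals of the exponents; the bidegree and the auxiliary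
   heights used below are all of this form. *)
Definition wt (w : 'I_N -> int) (q : 'X_{1..N}) : int := \sum_i w i * (q i)%:Z.

Lemma wtD w q i : wt w (q + U_(i)) = wt w q + w i.
Proof.
rewrite /wt (bigD1 i) //= [in RHS](bigD1 i) //= mnmDE mnm1E eqxx PoszD.
rewrite mulrDr mulr1 -!addrA [w i + _]addrC; congr (_ + (_ + _)).
by apply: eq_bigr => j /negPf nji; rewrite mnmDE mnm1E eq_sym nji addn0.
Qed.

Lemma wtB w q i : q i != 0%N -> wt w (q - U_(i)) = wt w q - w i.
Proof.
by move=> qi; rewrite -{2}(submK (m := U_(i)) (m' := q)) ?lep1mP // wtD addrK.
Qed.

(** [A] is an arbitrary predicate on weights, so that homogeneity ([d = l]) and height bounds
    ([d < N]) obey the same propagation rules: an operator of weight c acts by translating [A] by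
    c. *)
Definition wt_in (w : 'I_N -> int) (A : int -> Prop) (f : {mpoly K[N]}) :=
  forall q, f@_q != 0 -> A (wt w q).

Lemma wt_in0 w A : wt_in w A 0.
Proof. by move=> q; rewrite mcoeff0 eqxx. Qed.

Lemma wt_inZ w A c f : wt_in w A f -> wt_in w A (c *: f).
Proof. by move=> Af q; rewrite mcoeffZ mulf_eq0 negb_or => /andP[_ /Af]. Qed.

Lemma wt_inD w A f g : wt_in w A f -> wt_in w A g -> wt_in w A (f + g).
Proof.
move=> Af Ag q; rewrite mcoeffD.
by case: (eqVneq f@_q 0) => [->|/Af //]; rewrite add0r => /Ag.
Qed.

Lemma wt_inN w A f : wt_in w A f -> wt_in w A (- f).
Proof. by rewrite -scaleN1r; apply: wt_inZ. Qed.

Lemma wt_in_sum w A (I : Type) (r : seq I) (P : pred I) F :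
  (forall i, P i -> wt_in w A (F i)) -> wt_in w A (\sum_(i <- r | P i) F i).
Proof.
by move=> AF; apply: (big_ind (wt_in w A));
   [apply: wt_in0 | move=> *; apply: wt_inD | ].
Qed.

Lemma wt_in_mulXU w A i f :
  wt_in w A f -> wt_in w (fun d => A (d - w i)) ('X_i * f).
Proof.
move=> Af q; rewrite mcoeff_mulXU; case: (eqVneq (q i) 0%N) => [_|qi].
  by rewrite eqxx.
by move=> /Af; rewrite wtB.
Qed.

Lemma wt_in_mderiv w A i f :
  wt_in w A f -> wt_in w (fun d => A (d + w i)) f^`M(i).
Proof.
move=> Af q; rewrite mcoeff_deriv -mulr_natl mulf_eq0 negb_or => /andP[_ /Af].
by rewrite wtD.
Qed.

Lemma wt_in_mpolyX w (A : int -> Prop) q : A (wt w q) -> wt_in w A 'X_[q].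
Proof.
by move=> Aq p; rewrite mcoeffX; case: (eqVneq q p) => [<-|_] //; rewrite eqxx.
Qed.

Lemma sub_wt_in w (A A' : int -> Prop) f :
  (forall d, A d -> A' d) -> wt_in w A f -> wt_in w A' f.
Proof. by move=> sAA' Af q /Af /sAA'. Qed.

End Mpoly.

(** * Prop-valued subspaces and spans *)

Section Subspace.
Variables (K : fieldType) (V : lmodType K) (W : V -> Prop).
Hypothesis subW : is_subspace W.

Lemma subspace0 : W 0.
Proof. by case: subW. Qed.

Lemma subspaceZ c u : W u -> W (c *: u).
Proof. by case: subW => W0 WZD Wu; rewrite -[c *: u]addr0; apply: WZD. Qed.

Lemma subspaceD u v : W u -> W v -> W (u + v).
Proof.
by case: subW => W0 WZD Wu Wv; rewrite -[u]scale1r; apply: WZD.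
Qed.

Lemma subspaceN u : W u -> W (- u).
Proof. by move=> Wu; rewrite -scaleN1r; apply: subspaceZ. Qed.

Lemma subspaceB u v : W u -> W v -> W (u - v).
Proof. by move=> Wu Wv; apply: subspaceD => //; apply: subspaceN. Qed.

Lemma subspace_sum (I : Type) (r : seq I) (P : pred I) F :
  (forall i, P i -> W (F i)) -> W (\sum_(i <- r | P i) F i).
Proof.
by move=> WF; apply: (big_ind W); [case: subW | exact: subspaceD | ].
Qed.

Lemma subspace_cancelZ c u : c != 0 -> W (c *: u) -> W u.
Proof. by move=> c0 /(subspaceZ c^-1); rewrite scalerA mulVf // scale1r. Qed.

Lemma in_span_sub (P : V -> Prop) f :
  (forall g, P g -> W g) -> in_span P f -> W f.
Proof.
move=> PW [k [c [g [Pg ->]]]]; apply: subspace_sum => i _.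
exact/subspaceZ/PW.
Qed.

End Subspace.

Lemma in_span_big (K : fieldType) (V : lmodType K) (P : V -> Prop)
    (I : eqType) (r : seq I) (c : I -> K) (g : I -> V) :
  (forall i, i \in r -> P (g i)) -> in_span P (\sum_(i <- r) c i *: g i).
Proof.
move=> Pg; exists (size r), (fun j => c (tnth (in_tuple r) j)).
exists (fun j => g (tnth (in_tuple r) j)); split=> [j|].
  by apply: Pg; apply: mem_tnth.
by rewrite (big_tnth _ _ r).
Qed.

(** * Weyl algebra relations and the operators commuting with the action *)

Section Operators.
Variables (K : fieldType) (n : nat) (T : {set 'I_n}).
Notation B := {mpoly K[n + n]}.
Implicit Types (f g : B) (i j k : 'I_n) (q : 'X_{1..n + n}).

(* The Weyl algebra generators after the partial Fourier transform in the
   variables x_k with k in T: [Pop i, Qop j] = delta_ij in all cases. *)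
Definition Pop k f : B := if k \in T then - (xv K k * f) else dx k f.
Definition Qop k f : B := if k \in T then dx k f else xv K k * f.
Definition Yop k f : B := yv K k * f.

Lemma Pop_is_linear k : linear (Pop k).
Proof.
move=> c f g; rewrite /Pop /dx; case: ifP => _; last exact: linearP.
by rewrite mulrDr opprD scalerN scalerAr.
Qed.
HB.instance Definition _ k := GRing.isLinear.Build K B B _ (Pop k)
  (Pop_is_linear k).

Lemma Qop_is_linear k : linear (Qop k).
Proof.
move=> c f g; rewrite /Qop /dx; case: ifP => _; first exact: linearP.
by rewrite mulrDr scalerAr.
Qed.
HB.instance Definition _ k := GRing.isLinear.Build K B B _ (Qop k)
  (Qop_is_linear k).

Lemma Yop_is_linear k : linear (Yop k).
Proof. by move=> c f g; rewrite /Yop mulrDr scalerAr. Qed.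
HB.instance Definition _ k := GRing.isLinear.Build K B B _ (Yop k)
  (Yop_is_linear k).

Lemma dy_is_linear k : linear (@dy K n k).
Proof. by move=> c f g; rewrite /dy linearP. Qed.
HB.instance Definition _ k := GRing.isLinear.Build K B B _ (@dy K n k)
  (dy_is_linear k).

Lemma dxM i j f : dx i (xv K j * f) = xv K j * dx i f + (i == j)%:R *: f.
Proof. by rewrite /dx /xv mderiv_mulXU eq_lshift. Qed.

Lemma dxY i j f : dx i (Yop j f) = Yop j (dx i f).
Proof. by rewrite /dx /Yop /yv mderiv_mulXU eq_lrshift scale0r addr0. Qed.

Lemma dyX i j f : dy i (xv K j * f) = xv K j * dy i f.
Proof. by rewrite /dy /xv mderiv_mulXU eq_rlshift scale0r addr0. Qed.

Lemma dyY i j f : dy i (Yop j f) = Yop j (dy i f) + (i == j)%:R *: f.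
Proof. by rewrite /dy /Yop /yv mderiv_mulXU eq_rshift. Qed.

Lemma dxC i j f : dx i (dx j f) = dx j (dx i f).
Proof. exact: mderiv_comm. Qed.

Lemma dyC i j f : dy i (dy j f) = dy j (dy i f).
Proof. exact: mderiv_comm. Qed.

Lemma dxdyC i j f : dx i (dy j f) = dy j (dx i f).
Proof. exact: mderiv_comm. Qed.

Lemma dxN i f : dx i (- f) = - dx i f.
Proof. exact: mderivN. Qed.

Lemma dyN i f : dy i (- f) = - dy i f.
Proof. exact: mderivN. Qed.

Lemma Pop_Qop i j f : Pop i (Qop j f) = Qop j (Pop i f) + (i == j)%:R *: f.
Proof.
rewrite /Pop /Qop; case: ifP => iT; case: ifP => jT.
- by rewrite dxN dxM eq_sym opprD addrNK.
- rewrite mulrN mulrCA (negPf (_ : i != j)) ?scale0r ?addr0 //.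
  by apply: contraFN jT => /eqP <-.
- rewrite dxC (negPf (_ : i != j)) ?scale0r ?addr0 //.
  by apply: contraFN iT => /eqP ->.
- by rewrite dxM.
Qed.

Lemma PopC i j f : Pop i (Pop j f) = Pop j (Pop i f).
Proof.
rewrite /Pop; case: (eqVneq i j) => [->//|nij].
have nji : j != i by rewrite eq_sym.
case: ifP => iT; case: ifP => jT.
- by rewrite !mulrN mulrCA.
- by rewrite dxN dxM (negPf nji) scale0r addr0.
- by rewrite dxN dxM (negPf nij) scale0r addr0.
- by rewrite dxC.
Qed.

Lemma QopC i j f : Qop i (Qop j f) = Qop j (Qop i f).
Proof.
rewrite /Qop; case: (eqVneq i j) => [->//|nij].
have nji : j != i by rewrite eq_sym.
case: ifP => iT; case: ifP => jT.
- by rewrite dxC.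
- by rewrite dxM (negPf nij) scale0r addr0.
- by rewrite dxM (negPf nji) scale0r addr0.
- by rewrite mulrCA.
Qed.

Lemma YopC i j f : Yop i (Yop j f) = Yop j (Yop i f).
Proof. exact: mulrCA. Qed.

Lemma Pop_dy i j f : Pop i (dy j f) = dy j (Pop i f).
Proof. by rewrite /Pop; case: ifP => _; rewrite ?dyN ?dyX // dxdyC. Qed.

Lemma Qop_dy i j f : Qop i (dy j f) = dy j (Qop i f).
Proof. by rewrite /Qop; case: ifP => _; rewrite ?dyX // dxdyC. Qed.

Lemma Pop_Yop i j f : Pop i (Yop j f) = Yop j (Pop i f).
Proof.
rewrite /Pop; case: ifP => _; last by rewrite dxY.
by rewrite /Yop mulrN mulrCA.
Qed.

Lemma Qop_Yop i j f : Qop i (Yop j f) = Yop j (Qop i f).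
Proof.
rewrite /Qop; case: ifP => _; first by rewrite dxY.
by rewrite /Yop mulrCA.
Qed.

Lemma EactE i j f : Eact T i j f = Qop i (Pop j f) - Yop j (dy i f).
Proof.
rewrite /Eact /Qop /Pop /Yop; congr (_ - _).
case: ifP => iT; case: ifP => jT //.
- by rewrite dxN dxM opprD.
- by rewrite mulrN mulrA.
Qed.

Lemma DeltaE f : Delta T f = \sum_k Pop k (dy k f).
Proof.
rewrite /Delta [RHS](bigID (fun k => k \in T)) addrC -sumrN /=.
congr (_ + _); apply: eq_bigr => k kT; first by rewrite /Pop kT.
by rewrite /Pop (negPf kT).
Qed.

Lemma etaE f : eta T f = \sum_k Qop k (Yop k f).
Proof.
rewrite /eta [RHS](bigID (fun k => k \in T)) addrC /=.
congr (_ + _); apply: eq_bigr => k kT.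
  by rewrite Qop_Yop /Qop kT.
by rewrite /Qop (negPf kT) mulrA.
Qed.

Lemma Eact_is_linear i j : linear (@Eact K n T i j).
Proof.
move=> c f g; rewrite !EactE !(linearD, linearZ) /=.
by rewrite addrACA.
Qed.
HB.instance Definition _ i j := GRing.isLinear.Build K B B _ (@Eact K n T i j)
  (Eact_is_linear i j).

Lemma Delta_is_linear : linear (@Delta K n T).
Proof.
move=> c f g; rewrite !DeltaE scaler_sumr -big_split.
by apply: eq_bigr => k _; rewrite !linearP.
Qed.
HB.instance Definition _ := GRing.isLinear.Build K B B _ (@Delta K n T)
  Delta_is_linear.

Lemma eta_is_linear : linear (@eta K n T).
Proof.
move=> c f g; rewrite !etaE scaler_sumr -big_split.
by apply: eq_bigr => k _; rewrite !linearP.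
Qed.
HB.instance Definition _ := GRing.isLinear.Build K B B _ (@eta K n T)
  eta_is_linear.

Lemma osc_act_is_linear A : linear (@osc_act K n T A).
Proof.
move=> c f g; rewrite /osc_act scaler_sumr -big_split; apply: eq_bigr => i _.
rewrite scaler_sumr -big_split; apply: eq_bigr => j _ /=.
by rewrite linearP scalerDr !scalerA mulrC.
Qed.
HB.instance Definition _ A := GRing.isLinear.Build K B B _ (@osc_act K n T A)
  (osc_act_is_linear A).

Lemma sum_delta k (F : 'I_n -> B) : \sum_i (k == i)%:R *: F i = F k.
Proof.
rewrite (bigD1 k) //= eqxx scale1r big1 ?addr0 // => i nik.
by rewrite eq_sym (negPf nik) scale0r.
Qed.

(** The two halves Q_i P_j and y_j d/dy_i of E_ij have the same commutator with Delta, namely - P_j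
    d/dy_i, so these cancel in the difference. *)
Lemma Eact_Delta i j f : Eact T i j (Delta T f) = Delta T (Eact T i j f).
Proof.
have QP k : Qop i (Pop j (Pop k (dy k f))) =
    Pop k (dy k (Qop i (Pop j f))) - (i == k)%:R *: Pop j (dy k f).
  by rewrite (PopC j k) -Qop_dy -Pop_dy Pop_Qop eq_sym addrK.
have YD k : Yop j (dy i (Pop k (dy k f))) =
    Pop k (dy k (Yop j (dy i f))) - (j == k)%:R *: Pop k (dy i f).
  by rewrite -Pop_dy -Pop_Yop (dyC i k) dyY linearD linearZ /= eq_sym addrK.
rewrite !DeltaE linear_sum /=.
under eq_bigr do rewrite EactE QP YD opprB addrA addrAC.
rewrite big_split /=; have /= -> := sum_delta j (fun k => Pop k (dy i f)).
under eq_bigr do rewrite addrAC.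
rewrite sumrB; have /= -> := sum_delta i (fun k => Pop j (dy k f)).
rewrite addrNK.
by apply: eq_bigr => k _; rewrite EactE !linearB.
Qed.

(** As for Delta: both halves of E_ij have commutator Q_i y_j with eta. *)
Lemma Eact_eta i j f : Eact T i j (eta T f) = eta T (Eact T i j f).
Proof.
have QP k : Qop i (Pop j (Qop k (Yop k f))) =
    Qop k (Yop k (Qop i (Pop j f))) + (j == k)%:R *: Qop i (Yop k f).
  by rewrite Pop_Qop linearD linearZ /= (QopC i k) Pop_Yop Qop_Yop.
have YD k : Yop j (dy i (Qop k (Yop k f))) =
    Qop k (Yop k (Yop j (dy i f))) + (i == k)%:R *: Qop k (Yop j f).
  rewrite -Qop_dy dyY linearD linearZ /= linearD linearZ /=.
  by rewrite -!Qop_Yop (YopC j k).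
rewrite !etaE linear_sum /=.
under eq_bigr do rewrite EactE QP YD opprD addrACA.
rewrite big_split /= !sumrB; have /= -> := sum_delta j (fun k => Qop i (Yop k f)).
have /= -> := sum_delta i (fun k => Qop k (Yop j f)); rewrite subrr addr0 -sumrB.
by apply: eq_bigr => k _; rewrite EactE !linearB.
Qed.

End Operators.

(** * The bigrading and the commutator of Delta and eta *)

Section Gradings.
Variables (K : fieldType) (n : nat) (T : {set 'I_n}).
Notation B := {mpoly K[n + n]}.
Implicit Types (f g : B) (i j k : 'I_n) (q : 'X_{1..n + n}).
Implicit Types (u z : 'I_n -> int) (A : int -> Prop).

(* The sign on T makes [Qop k] raise this weight by u_k and [Pop k] lower it by
   u_k whether or not k belongs to T. *)
Definition wxy u z (i : 'I_(n + n)) : int :=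
  match split i with
  | inl k => if k \in T then - u k else u k
  | inr k => z k
  end.

Lemma wxyl u z k : wxy u z (lshift n k) = if k \in T then - u k else u k.
Proof. by rewrite /wxy -[lshift n k]/(unsplit (inl k)) unsplitK. Qed.

Lemma wxyr u z k : wxy u z (rshift n k) = z k.
Proof. by rewrite /wxy -[rshift n k]/(unsplit (inr k)) unsplitK. Qed.

Lemma wt_wxy u z q : wt (wxy u z) q =
  \sum_k (if k \in T then - u k else u k) * (q (lshift n k))%:Z
  + \sum_k z k * (q (rshift n k))%:Z.
Proof.
rewrite /wt big_split_ord /=; congr (_ + _).
  by apply: eq_bigr => k _; rewrite wxyl.
by apply: eq_bigr => k _; rewrite wxyr.
Qed.

Lemma wt_in_Pop u z A k f : wt_in (wxy u z) A f ->
  wt_in (wxy u z) (fun d => A (d + u k)) (Pop T k f).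
Proof.
rewrite /Pop => Af; case: ifP => kT.
  apply: wt_inN; apply: sub_wt_in (wt_in_mulXU Af) => d.
  by rewrite wxyl kT opprK.
by apply: sub_wt_in (wt_in_mderiv (i := lshift n k) Af) => d; rewrite wxyl kT.
Qed.

Lemma wt_in_Qop u z A k f : wt_in (wxy u z) A f ->
  wt_in (wxy u z) (fun d => A (d - u k)) (Qop T k f).
Proof.
rewrite /Qop => Af; case: ifP => kT.
  by apply: sub_wt_in (wt_in_mderiv (i := lshift n k) Af) => d; rewrite wxyl kT.
by apply: sub_wt_in (wt_in_mulXU Af) => d; rewrite wxyl kT.
Qed.

Lemma wt_in_Yop u z A k f : wt_in (wxy u z) A f ->
  wt_in (wxy u z) (fun d => A (d - z k)) (Yop k f).
Proof.
by move=> Af; apply: sub_wt_in (wt_in_mulXU Af) => d; rewrite wxyr.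
Qed.

Lemma wt_in_dy u z A k f : wt_in (wxy u z) A f ->
  wt_in (wxy u z) (fun d => A (d + z k)) (dy k f).
Proof.
by move=> Af; apply: sub_wt_in (wt_in_mderiv (i := rshift n k) Af) => d;
   rewrite wxyr.
Qed.

(** The condition on u and z says that Q_i P_j and y_j d/dy_i shift the weight by the same
    amount. *)
Lemma wt_in_Eact u z A A' i j f : u i - u j = z j - z i ->
  (forall d, A d -> A' (d + (u i - u j))) ->
  wt_in (wxy u z) A f -> wt_in (wxy u z) A' (Eact T i j f).
Proof.
move=> uz AA' Af; rewrite EactE; apply: wt_inD; last apply: wt_inN.
  apply: sub_wt_in (wt_in_Qop (wt_in_Pop Af)) => d /AA'.
  by rewrite [_ + (_ - _)](_ : _ = d) //; ring.
apply: sub_wt_in (wt_in_Yop (wt_in_dy Af)) => d /AA'.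
by rewrite uz [_ + (_ - _)](_ : _ = d) //; ring.
Qed.

Definition wX := wxy (fun=> 1) (fun=> 0).
Definition wY := wxy (fun=> 0) (fun=> 1).

Lemma wt_wX q : wt wX q = \sum_(j < n | j \notin T) (q (lshift n j))%:Z
  - \sum_(i < n | i \in T) (q (lshift n i))%:Z.
Proof.
rewrite wt_wxy [X in _ + X]big1 ?addr0 => [|k _]; last by rewrite mul0r.
rewrite (bigID (fun k => k \in T)) addrC -sumrN /=.
by congr (_ + _); apply: eq_bigr => k kT;
   rewrite ?kT ?(negPf kT) ?mulN1r ?mul1r.
Qed.

Lemma wt_wY q : wt wY q = \sum_(i < n) (q (rshift n i))%:Z.
Proof.
rewrite wt_wxy big1 ?add0r => [|k _].
  by apply: eq_bigr => k _; rewrite mul1r.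
by rewrite oppr0; case: ifP; rewrite mul0r.
Qed.

Lemma wt_wY_ge0 q : 0 <= wt wY q.
Proof. by rewrite wt_wY sumr_ge0. Qed.

Definition mnm_pair (a b : 'X_{1..n}) : 'X_{1..n + n} :=
  [multinom match split i with inl k => a k | inr k => b k end | i < n + n].

Lemma mnm_pairl a b k : mnm_pair a b (lshift n k) = a k.
Proof. by rewrite mnmE -[lshift n k]/(unsplit (inl k)) unsplitK. Qed.

Lemma mnm_pairr a b k : mnm_pair a b (rshift n k) = b k.
Proof. by rewrite mnmE -[rshift n k]/(unsplit (inr k)) unsplitK. Qed.

Definition xpart q : 'X_{1..n} := [multinom q (lshift n i) | i < n].
Definition ypart q : 'X_{1..n} := [multinom q (rshift n i) | i < n].

Lemma mnm_pairK q : mnm_pair (xpart q) (ypart q) = q.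
Proof.
apply/mnmP => i; rewrite -(splitK i); case: (split i) => k /=.
  by rewrite mnm_pairl mnmE.
by rewrite mnm_pairr mnmE.
Qed.

Lemma xymonE a b : xymon K a b = 'X_[mnm_pair a b].
Proof.
rewrite mpolyXE_id big_split_ord /=; congr (_ * _).
  by apply: eq_bigr => k _; rewrite mnm_pairl.
by apply: eq_bigr => k _; rewrite mnm_pairr.
Qed.

Lemma bidegreeP l1 l2 a b :
  bidegree T l1 l2 a b <-> wt wX (mnm_pair a b) = l1 /\ wt wY (mnm_pair a b) = l2.
Proof.
rewrite wt_wX wt_wY /bidegree mdegE (big_morph Posz PoszD (erefl 0%:Z)).
have xE (P : pred 'I_n) :
    \sum_(i | P i) (mnm_pair a b (lshift n i))%:Z = \sum_(i | P i) (a i)%:Z.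
  by apply: eq_bigr => i _; rewrite mnm_pairl.
have -> : \sum_(i < n) (mnm_pair a b (rshift n i))%:Z = \sum_i (b i)%:Z.
  by apply: eq_bigr => i _; rewrite mnm_pairr.
by rewrite !xE.
Qed.

Lemma BspP l1 l2 f : Bsp T l1 l2 f <->
  wt_in wX (fun d => d = l1) f /\ wt_in wY (fun d => d = l2) f.
Proof.
split=> [[k [c [g [Bg ->]]]] | [fX fY]].
  split; apply: wt_in_sum => i _; apply: wt_inZ;
    have [a [b [/bidegreeP[abX abY] ->]]] := Bg i;
    by rewrite xymonE; apply: wt_in_mpolyX.
rewrite [f]mpolyE; apply: in_span_big => q; rewrite mcoeff_msupp => fq.
exists (xpart q), (ypart q); rewrite xymonE mnm_pairK; split=> //.
by apply/bidegreeP; rewrite mnm_pairK; split; [apply: fX | apply: fY].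
Qed.

Lemma Bsp_subspace l1 l2 : is_subspace (@Bsp K n T l1 l2).
Proof.
split=> [|c f g /BspP[fX fY] /BspP[gX gY]]; apply/BspP.
  by split; apply: wt_in0.
by split; apply: wt_inD => //; apply: wt_inZ.
Qed.

Lemma Bsp_mpolyX l1 l2 q : wt wX q = l1 -> wt wY q = l2 -> @Bsp K n T l1 l2 'X_[q].
Proof. by move=> qX qY; apply/BspP; split; apply: wt_in_mpolyX. Qed.

Lemma Bsp_ind l1 l2 (W : B -> Prop) : is_subspace W ->
  (forall q, wt wX q = l1 -> wt wY q = l2 -> W 'X_[q]) ->
  forall f, Bsp T l1 l2 f -> W f.
Proof.
move=> subW Wq f; apply: in_span_sub => // _ [a [b [/bidegreeP[abX abY] ->]]].
by rewrite xymonE; apply: Wq.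
Qed.

Lemma Bsp_Pop l1 l2 k f : Bsp T l1 l2 f -> Bsp T (l1 - 1) l2 (Pop T k f).
Proof.
case/BspP => fX fY; apply/BspP; split.
  by apply: sub_wt_in (wt_in_Pop fX) => d <-; rewrite addrK.
by apply: sub_wt_in (wt_in_Pop fY) => d <-; rewrite addr0.
Qed.

Lemma Bsp_Qop l1 l2 k f : Bsp T l1 l2 f -> Bsp T (l1 + 1) l2 (Qop T k f).
Proof.
case/BspP => fX fY; apply/BspP; split.
  by apply: sub_wt_in (wt_in_Qop fX) => d <-; rewrite addrNK.
by apply: sub_wt_in (wt_in_Qop fY) => d <-; rewrite subr0.
Qed.

Lemma Bsp_Yop l1 l2 k f : Bsp T l1 l2 f -> Bsp T l1 (l2 + 1) (Yop k f).
Proof.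
case/BspP => fX fY; apply/BspP; split.
  by apply: sub_wt_in (wt_in_Yop fX) => d <-; rewrite subr0.
by apply: sub_wt_in (wt_in_Yop fY) => d <-; rewrite addrNK.
Qed.

Lemma Bsp_dy l1 l2 k f : Bsp T l1 l2 f -> Bsp T l1 (l2 - 1) (dy k f).
Proof.
case/BspP => fX fY; apply/BspP; split.
  by apply: sub_wt_in (wt_in_dy fX) => d <-; rewrite addr0.
by apply: sub_wt_in (wt_in_dy fY) => d <-; rewrite addrK.
Qed.

Lemma Bsp_Eact l1 l2 i j f : Bsp T l1 l2 f -> Bsp T l1 l2 (Eact T i j f).
Proof.
case/BspP => fX fY; apply/BspP.
by split; [apply: wt_in_Eact fX | apply: wt_in_Eact fY] => // d ->;
   rewrite subrr addr0.
Qed.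

Lemma mcoeff_xdx k f q :
  (xv K k * dx k f)@_q = (q (lshift n k))%:R * f@_q.
Proof. exact: mulXU_mderivE. Qed.

Lemma mcoeff_QopPop k f q : (Qop T k (Pop T k f))@_q =
  (if k \in T then - (q (lshift n k))%:Z - 1 else (q (lshift n k))%:Z)%:~R
  * f@_q.
Proof.
rewrite /Qop /Pop; case: (k \in T); last by rewrite mcoeff_xdx.
rewrite dxN dxM eqxx scale1r mcoeffN mcoeffD mcoeff_xdx.
by rewrite intrD intrN; ring.
Qed.

Lemma mcoeff_Yopdy k f q : (Yop k (dy k f))@_q = (q (rshift n k))%:R * f@_q.
Proof. exact: mulXU_mderivE. Qed.

(** For k in T, Q_k P_k = - x_k d/dx_k - 1; the constants - 1 add up to the shift by [#|T|] of the
    Euler operator. *)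
Lemma sum_Qop_Pop l1 l2 f : Bsp T l1 l2 f ->
  \sum_k Qop T k (Pop T k f) = (l1 - #|T|%:Z)%:~R *: f.
Proof.
case/BspP => fX _; apply/mpolyP => q; rewrite raddf_sum mcoeffZ /=.
under eq_bigr do rewrite mcoeff_QopPop.
rewrite -mulr_suml; case: (eqVneq f@_q 0) => [->|/fX <-]; first by rewrite !mulr0.
rewrite wt_wxy [X in _ = (_ + X - _)%:~R * _]big1 ?addr0 => [|k _].
  congr (_ * _); rewrite -rmorph_sum; congr (_%:~R).
  have -> : #|T|%:Z = \sum_k (k \in T)%:Z.
    rewrite -sum1_card big_mkcond (big_morph Posz PoszD (erefl 0%:Z)).
    by apply: eq_bigr => k _; case: (k \in T).
  by rewrite -sumrB; apply: eq_bigr => k _; case: (k \in T); lia.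
by rewrite mul0r.
Qed.

Lemma sum_Yop_dy l1 l2 f : Bsp T l1 l2 f ->
  \sum_k Yop k (dy k f) = l2%:~R *: f.
Proof.
case/BspP => _ fY; apply/mpolyP => q; rewrite raddf_sum mcoeffZ /=.
under eq_bigr do rewrite mcoeff_Yopdy.
rewrite -mulr_suml; case: (eqVneq f@_q 0) => [->|/fY <-]; first by rewrite !mulr0.
by rewrite wt_wY rmorph_sum.
Qed.

Lemma Bsp_Delta l1 l2 f : Bsp T l1 l2 f -> Bsp T (l1 - 1) (l2 - 1) (Delta T f).
Proof.
move=> Bf; rewrite DeltaE; apply: subspace_sum => [|k _].
  exact: Bsp_subspace.
exact/Bsp_Pop/Bsp_dy.
Qed.

Lemma Bsp_eta l1 l2 f : Bsp T l1 l2 f -> Bsp T (l1 + 1) (l2 + 1) (eta T f).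
Proof.
move=> Bf; rewrite etaE; apply: subspace_sum => [|k _].
  exact: Bsp_subspace.
exact/Bsp_Qop/Bsp_Yop.
Qed.

Lemma Bsp_lt0 l1 l2 f : l2 < 0 -> Bsp T l1 l2 f -> f = 0.
Proof.
move=> l2_lt0 /BspP[_ fY]; apply/mpolyP => q; rewrite mcoeff0; apply/eqP.
by apply: contraTT l2_lt0 => /fY <-; rewrite -leNgt wt_wY_ge0.
Qed.

(** The commutator of P_k d/dy_k with Q_l y_l is delta_kl (y_l d/dy_k + Q_l P_k + 1). Summing over k
    and l leaves the two Euler operators, with eigenvalues l2 and l1 - [#|T|], plus n. *)
Lemma Delta_eta l1 l2 f : Bsp T l1 l2 f ->
  Delta T (eta T f) =
  eta T (Delta T f) + (l1 + l2 + n%:Z - #|T|%:Z)%:~R *: f.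
Proof.
move=> Bf; rewrite DeltaE.
have PD k : Pop T k (dy k (eta T f)) = eta T (Pop T k (dy k f))
    + (Yop k (dy k f) + Qop T k (Pop T k f) + f).
  have PDl l : Pop T k (dy k (Qop T l (Yop l f))) =
      Qop T l (Yop l (Pop T k (dy k f)))
      + (k == l)%:R *: (Yop l (dy k f) + Qop T l (Pop T k f) + f).
    rewrite -Qop_dy dyY !(linearD, linearZ) /= !Pop_Qop Pop_Yop !scalerDr.
    by rewrite scalerA -natrM mulnb andbb !addrA.
  rewrite !etaE; transitivity (\sum_l Pop T k (dy k (Qop T l (Yop l f)))).
    by rewrite (linear_sum (@dy K n k)) /= (linear_sum (Pop T k)).
  under eq_bigr do rewrite PDl.
  rewrite big_split /=; congr (_ + _).
  exact: (sum_delta k (fun l => Yop l (dy k f) + Qop T l (Pop T k f) + f)).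
under eq_bigr => k _ do rewrite PD.
rewrite big_split -linear_sum -DeltaE /=; congr (_ + _).
rewrite !big_split /= (sum_Yop_dy Bf) (sum_Qop_Pop Bf) sumr_const card_ord.
rewrite -scaler_nat -!scalerDl; congr (_ *: _).
by rewrite !(intrD, intrN); ring.
Qed.

Lemma iter_Delta l1 l2 (k : nat) f : Bsp T l1 l2 f ->
  Bsp T (l1 - k%:Z) (l2 - k%:Z) (iter k (@Delta K n T) f).
Proof.
move=> Bf; elim: k => [|k IHk] /=; first by rewrite !subr0.
by have := Bsp_Delta IHk; rewrite -!addrA -!opprD -!PoszD addn1.
Qed.

(** Each Delta lowers l1 + l2 by 2, so the coefficient is the arithmetic sum of c - 2j for 0 <= j <=
    k, where c is the scalar of [Delta_eta]; it equals (k + 1)(c - k). *)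
Lemma iter_DeltaS_eta l1 l2 (k : nat) f : Bsp T l1 l2 f ->
  iter k.+1 (@Delta K n T) (eta T f) =
  eta T (iter k.+1 (@Delta K n T) f) +
  (k.+1%:Z * (l1 + l2 + n%:Z - #|T|%:Z - k%:Z))%:~R *: iter k (@Delta K n T) f.
Proof.
move=> Bf; elim: k => [|k IHk].
  by rewrite /= (Delta_eta Bf) mul1r subr0.
rewrite iterS IHk linearD linearZ /= (Delta_eta (iter_Delta k.+1 Bf)) /=.
rewrite -addrA -scalerDl; congr (_ + _ *: _).
by rewrite -intrD; congr (_%:~R); lia.
Qed.

Lemma iter_Delta0 (k : nat) : iter k (@Delta K n T) 0 = 0.
Proof. by elim: k => //= k ->; rewrite linear0. Qed.

(** * The direct sum decomposition *)

Section Decomposition.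
Hypothesis charK : forall k : nat, (k%:R == 0 :> K) = (k == 0%N).

Lemma intr_eq0_char (x : int) : (x%:~R == 0 :> K) = (x == 0).
Proof.
case: x => k; first by rewrite -pmulrn charK.
by rewrite NegzE intrN oppr_eq0 -pmulrn charK.
Qed.

Variables (l1 : int) (l2 : nat).
(** The excluded values are the zeros of the scalars of [iter_DeltaS_eta] at bidegree (l1 - 1, l2 -
    1), the source of [eta]. *)
Hypothesis nondegenerate : forall k : nat, (k < l2)%N ->
  l1 + l2%:Z + n%:Z - #|T|%:Z != k%:Z + 2.

Let etaB f := exists2 g, Bsp T (l1 - 1) (l2%:Z - 1) g & f = eta T g.

Lemma etaB_subspace : is_subspace etaB.
Proof.
split.
  by exists 0; [case: (Bsp_subspace (l1 - 1) (l2%:Z - 1)) | rewrite linear0].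
move=> c _ _ [g Bg ->] [h Bh ->]; exists (c *: g + h).
  by case: (Bsp_subspace (l1 - 1) (l2%:Z - 1)) => _; apply.
by rewrite linearP.
Qed.

Lemma iter_Delta_gt f : Bsp T l1 l2%:Z f -> iter l2.+1 (@Delta K n T) f = 0.
Proof. by move=> Bf; apply: Bsp_lt0 (iter_Delta l2.+1 Bf); lia. Qed.

(** Descent on the order of nilpotency: if Delta^(k+1) g = 0 and Delta (eta g) = 0, then
    [iter_DeltaS_eta] reduces to a nonzero multiple of Delta^k g being 0. For k = l2 the vanishing
    holds by degree. *)
Lemma eta_injective g :
  Bsp T (l1 - 1) (l2%:Z - 1) g -> Delta T (eta T g) = 0 -> g = 0.
Proof.
move=> Bg Deta0.
suff: forall k : nat, (k <= l2)%N -> iter k (@Delta K n T) g = 0 -> g = 0.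
  move=> /(_ l2 (leqnn _)); apply; apply: Bsp_lt0 (iter_Delta l2 Bg).
  by lia.
elim=> [//|k IHk] lt_kl Dg; apply: IHk; first exact: ltnW.
have := iter_DeltaS_eta k Bg; rewrite iterSr Deta0 iter_Delta0 Dg linear0 add0r.
move/esym/eqP; rewrite scaler_eq0 intr_eq0_char mulf_eq0 => /orP[|/eqP//].
by have := nondegenerate lt_kl; lia.
Qed.

Lemma Bsp_decomposition f :
  Bsp T l1 l2%:Z f -> exists h h' : B, [/\ Hsp T l1 l2%:Z h, etaB h' & f = h + h'].
Proof.
suff: forall k : nat, (k <= l2)%N -> forall f, Bsp T l1 l2%:Z f ->
    iter k.+1 (@Delta K n T) f = 0 ->
    exists h h' : B, [/\ Hsp T l1 l2%:Z h, etaB h' & f = h + h'].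
  by move=> decomp Bf; apply: (decomp l2) => //; apply: iter_Delta_gt.
elim=> [|k IHk] lt_kl {}f Bf Df.
  exists f, 0; rewrite addr0; split=> //; by case: etaB_subspace.
(* As Delta^(k+2) f = 0, [iter_DeltaS_eta] applied to Delta f gives Delta^(k+1) (eta (Delta f)) = a
   Delta^(k+1) f. Subtracting a^-1 eta (Delta f) from f therefore lowers the order of nilpotency. *)
pose a : K := (k.+1%:Z * (l1 + l2%:Z + n%:Z - #|T|%:Z - k%:Z - 2))%:~R.
have a0 : a != 0.
  by rewrite /a intr_eq0_char mulf_eq0 negb_or -addrA -opprD subr_eq0 nondegenerate.
have BDf := Bsp_Delta Bf.
have Beta : etaB (a^-1 *: eta T (Delta T f)).
  by exists (a^-1 *: Delta T f); rewrite ?linearZ //;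
     apply: subspaceZ => //; apply: Bsp_subspace.
have [h [h' [Hh Bh' def_f]]] : exists h h' : B,
    [/\ Hsp T l1 l2%:Z h, etaB h' & f - a^-1 *: eta T (Delta T f) = h + h'].
  apply: IHk; first exact: ltnW.
    apply: subspaceB => //; first exact: Bsp_subspace.
    apply: subspaceZ; first exact: Bsp_subspace.
    by have := Bsp_eta BDf; rewrite !addrNK.
  have linD : linear (iter k.+1 (@Delta K n T)).
    by move=> c x y; elim: (k.+1) => //= k' ->; rewrite linearP.
  have -> : f - a^-1 *: eta T (Delta T f) = - a^-1 *: eta T (Delta T f) + f.
    by rewrite scaleNr addrC.
  rewrite linD (iter_DeltaS_eta k BDf) -iterSr Df linear0 add0r -iterSr.
  rewrite scaleNr scalerA [X in _^-1 * X](_ : _ = a).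
    by rewrite mulVf // scale1r addNr.
  by congr (_%:~R); lia.
exists h, (h' + a^-1 *: eta T (Delta T f)); split=> //.
  by apply: subspaceD => //; apply: etaB_subspace.
by rewrite addrA -def_f addrNK.
Qed.

Lemma Bsp_direct_sum :
  direct_sum (@Bsp K n T l1 l2%:Z) (@Hsp K n T l1 l2%:Z) etaB.
Proof.
split=> [f|f [_ Deta0] [g Bg def_f]].
  split; first exact: Bsp_decomposition.
  move=> [h [_ [[Bh _] [g Bg ->] ->]]]; apply: subspaceD => //.
    exact: Bsp_subspace.
  by have := Bsp_eta Bg; rewrite !addrNK.
by rewrite def_f in Deta0 *; rewrite (eta_injective Bg Deta0) linear0.
Qed.

End Decomposition.
End Gradings.

(** * The operators on monomials *)

Section Monomials.
Variables (K : fieldType) (n : nat) (T : {set 'I_n}).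
Notation B := {mpoly K[n + n]}.
Implicit Types (k : 'I_n) (q : 'X_{1..n + n}).

Lemma Pop_Qop_mpolyX k q : Pop T k (Qop T k 'X_[q]) =
  (if k \in T then - (q (lshift n k))%:Z else (q (lshift n k))%:Z + 1)%:~R
  *: 'X_[q] :> B.
Proof.
rewrite Pop_Qop eqxx scale1r; apply/mpolyP => p.
rewrite mcoeffD mcoeffZ mcoeff_QopPop mcoeffX.
case: (eqVneq q p) => [<-|_]; last by rewrite !mulr0 addr0.
by rewrite !mulr1 -[X in _ + X]/(1%:~R) -intrD; congr (_%:~R); case: ifP => _; ring.
Qed.

Lemma Yop_dy_mpolyX k q :
  Yop k (dy k 'X_[q]) = (q (rshift n k))%:R *: 'X_[q] :> B.
Proof.
apply/mpolyP => p; rewrite mcoeffZ mcoeff_Yopdy mcoeffX.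
by case: (eqVneq q p) => [<-|_]; rewrite ?mulr0.
Qed.

Lemma Qop_mpolyX k q : k \notin T ->
  Qop T k 'X_[q] = 'X_[q + U_(lshift n k)] :> B.
Proof. by move=> kT; rewrite /Qop (negPf kT) /xv mulXU_mpolyX. Qed.

Lemma Pop_mpolyX k q : k \in T ->
  Pop T k 'X_[q] = - 'X_[q + U_(lshift n k)] :> B.
Proof. by move=> kT; rewrite /Pop kT /xv mulXU_mpolyX. Qed.

Lemma Yop_mpolyX k q : Yop k 'X_[q] = 'X_[q + U_(rshift n k)] :> B.
Proof. by rewrite /Yop /yv mulXU_mpolyX. Qed.

Lemma dy_mpolyX k q :
  dy k 'X_[q] = (q (rshift n k))%:R *: 'X_[q - U_(rshift n k)] :> B.
Proof. by rewrite /dy mderivX. Qed.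

(* The second term vanishes unless y_j divides 'X_[p]. *)
Lemma Eact_Qop_mpolyX b j p : b \notin T -> j \notin T ->
  Eact T j b (Qop T b 'X_[p]) =
  (p (lshift n b)).+1%:R *: 'X_[p + U_(lshift n j)] -
  (p (rshift n j))%:R *:
    'X_[p - U_(rshift n j) + U_(lshift n b) + U_(rshift n b)] :> B.
Proof.
move=> bT jT; rewrite EactE Pop_Qop_mpolyX (negPf bT) linearZ /= Qop_mpolyX //.
rewrite -[_ + 1]/(Posz _) addn1 -pmulrn -Qop_dy dy_mpolyX !linearZ /=.
by rewrite Qop_mpolyX // Yop_mpolyX.
Qed.

(** Adding Q_k y_k d/dy_e f to E_ek Q_k f cancels the y-part and leaves Q_e P_k Q_k f, whose sum
    over k is an Euler operator. On monomials, for the last index e, this expresses a multiple of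
    Q_e f by lowering operators modulo the image of eta. *)
Lemma sum_Eact_Qop e l1 l2 f : Bsp T (l1 - 1) l2 f ->
  \sum_(k | k != e) Eact T e k (Qop T k f) + eta T (dy e f) =
  (l1 - 1 + n%:Z - #|T|%:Z)%:~R *: Qop T e f - Eact T e e (Qop T e f) :> B.
Proof.
move=> Bf; apply: (canRL (addrK _)); rewrite addrAC.
have -> : \sum_(k | k != e) Eact T e k (Qop T k f) + Eact T e e (Qop T e f) =
    \sum_k Eact T e k (Qop T k f) by rewrite [RHS](bigD1 e) //= addrC.
rewrite etaE -big_split /=.
rewrite (eq_bigr (fun k => Qop T e (Qop T k (Pop T k f) + f))) => [|k _].
  rewrite -linear_sum big_split /= (sum_Qop_Pop Bf) sumr_const card_ord.
  rewrite -scaler_nat -scalerDl linearZ /=; congr (_ *: _).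
  by rewrite !(intrD, intrN); ring.
rewrite EactE Pop_Qop eqxx scale1r -Qop_dy -Qop_Yop.
by rewrite addrNK.
Qed.

End Monomials.

(** * Spanning by lowering operators from the highest weight monomial *)

Section Spanning.
Variables (K : fieldType) (m s : nat).
Hypothesis charK : forall k : nat, (k%:R == 0 :> K) = (k == 0%N).
Notation n := m.+1.
Notation B := {mpoly K[n + n]}.
Notation T := (Tset m s).
Notation e := (@ord_max m).
Implicit Types (f g : B) (i j k : 'I_n) (q : 'X_{1..n + n}).

Lemma in_Tset i : (i \in T) = (i < s)%N. Proof. by rewrite inE. Qed.

(** The constants make all variables of nonnegative height: x_i has height s - i - 1 on T and i + 1
    - s on S, and y_i has height m - i. Only the last x of T and the last y have height 0. *)
Definition hx i : int := i.+1%:Z - s%:Z.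
Definition hy i : int := m%:Z - i%:Z.
(* [Eact T i j] lowers this weight by j - i. *)
Definition wH := wxy T hx hy.

Lemma wH_ge0 q : 0 <= wt wH q.
Proof.
rewrite wt_wxy addr_ge0 // sumr_ge0 // => i _; rewrite mulr_ge0 //.
  by case: ifPn; rewrite in_Tset /hx; lia.
by have := ltn_ord i; rewrite /hy; lia.
Qed.

Lemma wH_lt0 f : wt_in wH (fun d => d < 0) f -> f = 0.
Proof.
move=> f_lt0; apply/mpolyP => q; rewrite mcoeff0; apply/eqP.
by have := wH_ge0 q; rewrite leNgt; apply: contraNT => /f_lt0.
Qed.

Hypothesis s_lt_m : (s < m)%N.
(** [a] is the last index of T and [b] the first index of S, counted from 0. *)
Variables (a b : 'I_n) (l1 : int) (l2 : nat).
Hypotheses (aE : a.+1 = s) (bE : b = s :> nat).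

Hypothesis nonresonant :
  l1 + l2%:Z <= - (n%:Z - s%:Z - 1) \/ - (n%:Z - s%:Z - 1) < l1.

Lemma leq_y q k : wt (wY T) q = l2%:Z -> (q (rshift n k) <= l2)%N.
Proof.
rewrite wt_wY (bigD1 k) //= => /esym qY; rewrite -lez_nat qY lerDl.
exact: sumr_ge0.
Qed.

Lemma card_Tset : #|T| = s.
Proof.
rewrite -sum1_card -[RHS]card_ord -sum1_card.
rewrite (big_ord_widen _ (fun=> 1%N) (leqW (ltnW s_lt_m))).
by apply: eq_bigl => i; rewrite in_Tset.
Qed.

Lemma a_in_T : a \in T. Proof. by rewrite in_Tset -aE. Qed.
Lemma b_notin_T : b \notin T. Proof. by rewrite in_Tset bE ltnn. Qed.
Lemma e_notin_T : e \notin T. Proof. by rewrite in_Tset -leqNgt ltnW. Qed.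

(** These conditions leave one monomial: x_a^(-l1) y_n^l2 if l1 <= 0, and x_b^l1 y_n^l2 otherwise.
    Stating them this way treats both signs of l1 at once. *)
Definition hw_exponent q :=
  [/\ wt (wX T) q = l1, wt (wY T) q = l2%:Z,
      forall i, i != e -> q (rshift n i) = 0%N,
      forall i, i != a -> i != b -> q (lshift n i) = 0%N &
      q (lshift n a) = 0%N \/ q (lshift n b) = 0%N].

Section Lowering.
Variable W : B -> Prop.
Hypothesis subW : is_subspace W.
Hypothesis W_Eact : forall i j f, (i < j)%N -> W f -> W (Eact T j i f).
Hypothesis W_eta : forall g, Bsp T (l1 - 1) (l2%:Z - 1) g -> W (eta T g).
Hypothesis W_hw : forall q, hw_exponent q -> W 'X_[q].

Section Step.
Variable N : nat.
(** The induction hypothesis on the height; the section extends it to monomials of height at most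
    [N]. *)
Hypothesis W_low : forall f,
  Bsp T l1 l2%:Z f -> wt_in wH (fun d => d < N%:Z) f -> W f.

Lemma W_low_mpolyX q : wt (wX T) q = l1 -> wt (wY T) q = l2%:Z ->
  wt wH q < N%:Z -> W 'X_[q].
Proof.
by move=> qX qY qH; apply: W_low; [apply: Bsp_mpolyX | apply: wt_in_mpolyX].
Qed.

(* If y_n has the larger exponent, q comes with a nonzero scalar from
   [sum_Eact_Qop]; otherwise from E_(n, s+1), up to a monomial divisible by a
   smaller power of y_n. *)
Lemma W_mpolyX_xn (t : nat) q : q (rshift n e) = t -> q (lshift n e) != 0%N ->
  wt (wX T) q = l1 -> wt (wY T) q = l2%:Z -> wt wH q <= N%:Z -> W 'X_[q].
Proof.
(* The correcting monomial below has the same height as q, so [W_low] does not reach it; what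
   decreases is the exponent t of y_n. *)
elim/ltn_ind: t q => t IHt q q_ye q_xe qX qY qH.
have lt_be : (b < e)%N by rewrite bE.
pose p := (q - U_(lshift n e))%MM.
have def_q : (p + U_(lshift n e))%MM = q by rewrite submK // lep1mP.
have pX : wt (wX T) p = l1 - 1.
  by rewrite wtB // qX /wX wxyl (negPf e_notin_T).
have pY : wt (wY T) p = l2%:Z.
  by rewrite wtB // qY /wY wxyl (negPf e_notin_T) subr0.
have pH : wt wH p = wt wH q - hx e.
  by rewrite wtB // /wH wxyl (negPf e_notin_T).
have p_ye : p (rshift n e) = t by rewrite mnmBE mnm1E eq_lrshift subn0.
have p_xe : (p (lshift n e)).+1 = q (lshift n e).
  by rewrite mnmBE mnm1E eqxx subn1 prednK // lt0n.
clearbody p.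
have Bp : Bsp T (l1 - 1) l2%:Z ('X_[p] : B) by apply: Bsp_mpolyX.
(* Replacing a factor x_n by Q_k with k < n lowers the height. *)
have W_Qp k : (k < e)%N -> W (Qop T k 'X_[p]).
  move=> lt_ke; apply: W_low; first by have := Bsp_Qop k Bp; rewrite addrNK.
  apply: sub_wt_in (wt_in_Qop (A := fun d => d <= N%:Z - hx e) _) => [d|].
    by rewrite /hx /=; have : (k < m)%N by []; lia.
  by apply: wt_in_mpolyX; rewrite pH; lia.
have [lt_yx|le_xy] := ltnP (q (rshift n e)) (q (lshift n e)).
  apply: (@subspace_cancelZ _ _ _ subW (p (lshift n b)).+1%:R).
    by rewrite charK.
  have := Eact_Qop_mpolyX K p b_notin_T e_notin_T.
  rewrite def_q => /esym/eqP; rewrite subr_eq => /eqP ->; apply: subspaceD => //.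
    exact/W_Eact/W_Qp.
  rewrite p_ye; case: t => [|t] in IHt q_ye p_ye *.
    by rewrite scale0r; apply: subspace0.
  have be : (b == e) = false by apply/eqP => be; rewrite be ltnn in lt_be.
  apply: (subspaceZ subW); apply: (IHt t) => //.
  - rewrite !(mnmDE, mnmBE, mnm1E) eq_lrshift !eq_rshift eqxx be p_ye.
    by rewrite subn1 !addn0.
  (* Here y_n divides q and x_n has the larger exponent, so that exponent is at least 2 and x_n
     still divides the correcting monomial. *)
  - rewrite !(mnmDE, mnmBE, mnm1E) eq_rlshift subn0 -lt0n !addn_gt0.
    by have -> : (0 < p (lshift n e))%N by lia.
  - rewrite !wtD wtB ?p_ye // pX /wX !wxyl !wxyr (negPf b_notin_T).
    by rewrite subr0 addr0 addrNK.
  - rewrite !wtD wtB ?p_ye // pY /wY !wxyl !wxyr (negPf b_notin_T).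
    by rewrite addr0 addrNK.
  - rewrite !wtD wtB ?p_ye // pH /wH !wxyl !wxyr (negPf b_notin_T).
    by rewrite -/wH /hx /hy; lia.
have W_sum : W ((l1 + m%:Z - s%:Z + (q (rshift n e))%:Z
    - (q (lshift n e))%:Z)%:~R *: 'X_[q]).
  have <- : \sum_(k | k != e) Eact T e k (Qop T k 'X_[p]) + eta T (dy e 'X_[p])
      = (l1 + m%:Z - s%:Z + (q (rshift n e))%:Z - (q (lshift n e))%:Z)%:~R
        *: 'X_[q] :> B.
    rewrite (sum_Eact_Qop e Bp) EactE Pop_Qop_mpolyX (negPf e_notin_T) linearZ.
    rewrite /= Qop_mpolyX ?e_notin_T // def_q Yop_dy_mpolyX -scalerBl -scalerBl.
    by rewrite pmulrn -!intrB card_Tset; congr (_%:~R *: _); lia.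
  apply: subspaceD => //.
    apply: subspace_sum => // k ke; have lt_ke : (k < e)%N.
      by rewrite ltn_neqAle -ltnS ltn_ord andbT.
    exact/W_Eact/W_Qp.
  exact/W_eta/Bsp_dy.
apply: (subspace_cancelZ subW) W_sum; rewrite intr_eq0_char //.
(* The difference of the exponents of y_n and x_n lies between 0 and l2 - 1, so the scalar is
   negative if l1 + l2 <= - (n - s - 1) and positive if l1 > - (n - s - 1). *)
have := leq_y e qY; case: nonresonant; lia.
Qed.

Lemma W_Qop_xn f : Bsp T (l1 - 1) l2%:Z f ->
  wt_in wH (fun d => d <= N%:Z - hx e) f -> W (Qop T e f).
Proof.
move=> /BspP[fX fY] fH; rewrite [f]mpolyE linear_sum; apply: subspace_sum => // q _.
case: (eqVneq f@_q 0) => [->|fq]; first by rewrite scale0r linear0; apply: subspace0.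
rewrite linearZ /= Qop_mpolyX ?e_notin_T //; apply: subspaceZ => //.
apply: W_mpolyX_xn => //.
- by rewrite mnmDE mnm1E eqxx addn1.
- by rewrite wtD fX // /wX wxyl (negPf e_notin_T) addrNK.
- by rewrite wtD fY // /wY wxyl (negPf e_notin_T) addr0.
- by rewrite wtD /wH wxyl (negPf e_notin_T) -lerBrDr; apply: fH.
Qed.

(** Trading a factor y_i for y_n gives f of smaller height. In E_(n,i) f the part y_i d/dy_n f is a
    nonzero multiple of the monomial, and the part Q_n P_i f, of the original height, is covered by
    [W_Qop_xn]. *)
Lemma W_mpolyX_y q i : i != e -> q (rshift n i) != 0%N ->
  wt (wX T) q = l1 -> wt (wY T) q = l2%:Z -> wt wH q <= N%:Z -> W 'X_[q].
Proof.
move=> ie q_yi qX qY qH.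
have lt_ie : (i < e)%N by rewrite ltn_neqAle -ltnS ltn_ord andbT.
pose p := (q - U_(rshift n i))%MM.
have def_q : (p + U_(rshift n i))%MM = q by rewrite submK // lep1mP.
pose f : B := Yop e 'X_[p].
have fE : f = 'X_[p + U_(rshift n e)] by rewrite /f Yop_mpolyX.
have Bf : Bsp T l1 l2%:Z f.
  rewrite fE; apply: Bsp_mpolyX; rewrite wtD wtB ?q_yi //.
    by rewrite qX /wX !wxyr addr0 subr0.
  by rewrite qY /wY !wxyr subrK.
have fH : wt_in wH (fun d => d = wt wH q - hy i + hy e) f.
  by rewrite fE; apply: wt_in_mpolyX; rewrite wtD wtB // /wH !wxyr.
have Wf : W f.
  apply: W_low => //; apply: sub_wt_in fH => _ ->.
  by rewrite /hy /=; move: lt_ie => /=; lia.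
have Yf : Yop i (dy e f) = (p (rshift n e)).+1%:R *: 'X_[q].
  rewrite dyY Yop_dy_mpolyX eqxx -scalerDl -natrD addn1 linearZ /=.
  by rewrite Yop_mpolyX def_q.
apply: (@subspace_cancelZ _ _ _ subW (p (rshift n e)).+1%:R); first by rewrite charK.
have -> : (p (rshift n e)).+1%:R *: 'X_[q] = Qop T e (Pop T i f) - Eact T e i f.
  by rewrite -Yf EactE opprB addrCA subrr addr0.
apply: subspaceB => //; last exact: W_Eact.
apply: W_Qop_xn; first exact: Bsp_Pop.
apply: sub_wt_in (wt_in_Pop fH) => d.
by rewrite /hy /hx => /(canRL (addrK _)) ->; lia.
Qed.

Lemma W_mpolyX q :
  wt (wX T) q = l1 -> wt (wY T) q = l2%:Z -> wt wH q <= N%:Z -> W 'X_[q].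
Proof.
move=> qX qY qH.
case: (eqVneq (q (lshift n e)) 0%N) => q_xe; last exact: W_mpolyX_xn q_xe _ _ _.
have [/existsP[i /andP[ie q_yi]]|/existsPn y0] :=
  boolP [exists i, (i != e) && (q (rshift n i) != 0%N)].
  exact: W_mpolyX_y q_yi _ _ _.
have q_y i : i != e -> q (rshift n i) = 0%N.
  by move=> ie; have := y0 i; rewrite ie negbK => /eqP.
have ae : a != e by apply/eqP => ae; have := aE; rewrite ae /= => ae_s; lia.
have be : b != e by apply/eqP => be; have := bE; rewrite be /= => be_s; lia.
(* Only y_n is left among the y's, so the y-part of the lowering operators used below vanishes. A
   factor x_j is produced from x_a by E_(a,j) if j is in T, and from x_b by E_(j,b) if j is in S. *)
have [/existsP[j /and3P[ja jb q_xj]]|/existsPn x0] :=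
  boolP [exists i, [&& i != a, i != b & q (lshift n i) != 0%N]].
  pose p := (q - U_(lshift n j))%MM.
  have def_q : (p + U_(lshift n j))%MM = q by rewrite submK // lep1mP.
  have p_y i : i != e -> p (rshift n i) = 0%N.
    by move=> ie; rewrite mnmBE mnm1E eq_lrshift subn0 q_y.
  have je : j != e by apply: contraNneq q_xj => ->; rewrite q_xe.
  have pX : wt (wX T) p = l1 - (if j \in T then -1 else 1).
    by rewrite wtB // qX /wX wxyl.
  have pY : wt (wY T) p = l2%:Z by rewrite wtB // qY /wY wxyl oppr0 if_same subr0.
  have pH : wt wH p = wt wH q - (if j \in T then - hx j else hx j).
    by rewrite wtB // /wH wxyl.
  clearbody p.
  case: (boolP (j \in T)) => jT; rewrite ?jT ?(negPf jT) in pX pH.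
    have lt_ja : (j < a)%N.
      by move: ja jT; rewrite in_Tset -val_eqE /=; have := aE; lia.
    apply: (@subspace_cancelZ _ _ _ subW (p (lshift n a)).+1%:R).
      by rewrite charK.
    have -> : (p (lshift n a)).+1%:R *: 'X_[q] =
        - Eact T a j 'X_[p + U_(lshift n a)] :> B.
      rewrite EactE dy_mpolyX !(mnmDE, mnm1E) eq_lrshift p_y // scale0r linear0.
      rewrite subr0 Pop_mpolyX // linearN opprK /= /Qop a_in_T /dx mderivX.
      rewrite !mnmDE !mnm1E !eqxx eq_lshift (negPf ja) addn0 addn1.
      by rewrite -addmA [(U_(lshift n a) + _)%MM]addmC addmA addmK def_q.
    apply: (subspaceN subW); apply: W_Eact => //; apply: W_low_mpolyX.
    - by rewrite wtD pX /wX wxyl a_in_T; lia.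
    - by rewrite wtD pY /wY wxyl a_in_T oppr0 addr0.
    - by rewrite wtD pH /wH wxyl a_in_T -/wH /hx; lia.
  have lt_bj : (b < j)%N.
    by move: jb jT; rewrite in_Tset -val_eqE /=; have := bE; lia.
  apply: (@subspace_cancelZ _ _ _ subW (p (lshift n b)).+1%:R).
    by rewrite charK.
  have := Eact_Qop_mpolyX K p b_notin_T jT.
  rewrite p_y // scale0r subr0 def_q Qop_mpolyX ?b_notin_T // => <-.
  apply: W_Eact => //; apply: W_low_mpolyX.
  - by rewrite wtD pX /wX wxyl (negPf b_notin_T) addrNK.
  - by rewrite wtD pY /wY wxyl (negPf b_notin_T) addr0.
  - by rewrite wtD pH /wH wxyl (negPf b_notin_T) -/wH /hx; lia.
(* A product x_a x_b is created by E_(b,a), which multiplies by - x_a x_b here. *)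
have [/andP[q_xa q_xb]|q_ab] :=
  boolP ((q (lshift n a) != 0%N) && (q (lshift n b) != 0%N)).
  have lt_ab : (a < b)%N by have := aE; have := bE; lia.
  have ba : b != a by apply/eqP => ba; rewrite ba ltnn in lt_ab.
  pose p := (q - U_(lshift n a) - U_(lshift n b))%MM.
  have p_xb : (q - U_(lshift n a))%MM (lshift n b) != 0%N.
    by rewrite mnmBE mnm1E eq_lshift [a == b]eq_sym (negPf ba) subn0.
  have def_q : (p + U_(lshift n b) + U_(lshift n a))%MM = q.
    by rewrite !submK // lep1mP.
  have -> : 'X_[q] = - Eact T b a 'X_[p] :> B.
    rewrite EactE dy_mpolyX !mnmBE !mnm1E !eq_lrshift !subn0 q_y // scale0r.
    rewrite linear0 subr0 Pop_mpolyX ?a_in_T // linearN opprK /=.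
    rewrite Qop_mpolyX ?b_notin_T // -addmA [(U_(lshift n a) + _)%MM]addmC.
    by rewrite addmA def_q.
  apply: (subspaceN subW); apply: W_Eact => //; apply: W_low_mpolyX.
  - rewrite !wtB // qX /wX !wxyl a_in_T (negPf b_notin_T); lia.
  - by rewrite !wtB // qY /wY !wxyl a_in_T (negPf b_notin_T); lia.
  - rewrite !wtB // /wH !wxyl a_in_T (negPf b_notin_T) -/wH /hx.
    by have := aE; have := bE; lia.
apply: W_hw; split=> //.
  by move=> i ia ib; have := x0 i; rewrite ia ib negbK => /eqP.
by move: q_ab; rewrite negb_and !negbK => /orP[/eqP|/eqP]; [left | right].
Qed.

End Step.

Lemma lowering_span f : Bsp T l1 l2%:Z f -> W f.
Proof.
have W_bounded (N : nat) : forall f, Bsp T l1 l2%:Z f ->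
    wt_in wH (fun d => d < N%:Z) f -> W f.
  elim: N => [|N IHN] {}f Bf fH; first by rewrite (wH_lt0 fH); apply: subspace0.
  rewrite [f]mpolyE; apply: subspace_sum => // q _.
  case: (eqVneq f@_q 0) => [->|fq]; first by rewrite scale0r; apply: subspace0.
  apply: subspaceZ => //; case/BspP: Bf => fX fY.
  apply: (@W_mpolyX N) => //; [exact: fX | exact: fY |].
  by have := fH _ fq; lia.
move=> Bf; elim/Bsp_ind: f / Bf => // q qX qY.
apply: (W_bounded `|wt wH q|.+1); first exact: Bsp_mpolyX.
by apply: wt_in_mpolyX; lia.
Qed.

End Lowering.
End Spanning.

(** * The contravariant form *)

Section Form.
Variables (K : fieldType) (n : nat) (T : {set 'I_n}).
Notation B := {mpoly K[n + n]}.
Implicit Types (f g : B) (i j k : 'I_n) (q : 'X_{1..n + n}).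

(** The sign - 1 on x_k for k in T compensates P_k = - x_k there, making P_k and Q_k adjoint for
    every k. *)
Definition msign (i : 'I_(n + n)) : K :=
  match split i with
  | inl k => if k \in T then -1 else 1
  | inr _ => 1
  end.

Lemma msignl k : msign (lshift n k) = if k \in T then -1 else 1.
Proof. by rewrite /msign -[lshift n k]/(unsplit (inl k)) unsplitK. Qed.

Lemma msignr k : msign (rshift n k) = 1.
Proof. by rewrite /msign -[rshift n k]/(unsplit (inr k)) unsplitK. Qed.

Lemma msignK (i : 'I_(n + n)) : msign i * msign i = 1.
Proof.
rewrite /msign; case: (split i) => k; last by rewrite mulr1.
by case: ifP => _; rewrite ?mulrNN mulr1.
Qed.

(* The square of the monomial 'X_[q] for the contravariant form, in which
   distinct monomials are orthogonal. *)
Definition mnorm q : K := \prod_i (msign i ^+ q i * (q i)`!%:R).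

Lemma mnormD (i : 'I_(n + n)) q :
  mnorm (q + U_(i)) = msign i * (q i).+1%:R * mnorm q.
Proof.
rewrite /mnorm (bigD1 i) //= [in RHS](bigD1 i) //= mnmDE mnm1E eqxx addn1.
rewrite exprS factS natrM; set r := \prod_(_ | _) _; set r' := \prod_(_ | _) _.
have -> : r = r'.
  by apply: eq_bigr => j /negPf ji; rewrite mnmDE mnm1E eq_sym ji addn0.
by ring.
Qed.

(** Summing over the support of g alone makes linearity in f immediate; [cformE] moves the sum to
    the support of f, which gives linearity in g and symmetry. *)
Definition cform g f : K := \sum_(q <- msupp g) f@_q * (mnorm q * g@_q).

Lemma cformP g c f h : cform g (c *: f + h) = c * cform g f + cform g h.
Proof.
rewrite /cform mulr_sumr -big_split; apply: eq_bigr => q _.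
by rewrite mcoeffD mcoeffZ mulrDl mulrA -!mulrA.
Qed.

Lemma cform_mpolyX g q : cform g 'X_[q] = mnorm q * g@_q.
Proof.
rewrite /cform; case: (boolP (q \in msupp g)) => [gq|gq].
  rewrite (bigD1_seq q) //= mcoeffX eqxx mul1r big1 ?addr0 // => p pq.
  by rewrite mcoeffX eq_sym (negPf pq) mul0r.
rewrite (memN_msupp_eq0 gq) mulr0 big_seq big1 // => p gp.
rewrite mcoeffX; case: (eqVneq q p) => [qp|_]; last by rewrite mul0r.
by rewrite qp gp in gq.
Qed.

Lemma cform_kernel_subspace g : is_subspace (fun f => cform g f = 0).
Proof.
split=> [|c f h gf gh].
  by rewrite /cform big1 // => q _; rewrite mcoeff0 mul0r.
by rewrite cformP gf gh mulr0 addr0.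
Qed.

Lemma cformE g f : cform g f = \sum_(q <- msupp f) f@_q * (mnorm q * g@_q).
Proof.
rewrite {1}[f]mpolyE; elim: (msupp f) => [|q r IHr].
  rewrite !big_nil; by case: (cform_kernel_subspace g).
by rewrite !big_cons cformP IHr cform_mpolyX.
Qed.

Lemma cformDl g g' f : cform (g + g') f = cform g f + cform g' f.
Proof.
rewrite !cformE -big_split; apply: eq_bigr => q _.
by rewrite mcoeffD mulrDr mulrDr.
Qed.

Lemma cformZl c g f : cform (c *: g) f = c * cform g f.
Proof.
rewrite !cformE mulr_sumr; apply: eq_bigr => q _.
by rewrite mcoeffZ; ring.
Qed.

Lemma cform_suml I (r : seq I) (G : I -> B) f :
  cform (\sum_(i <- r) G i) f = \sum_(i <- r) cform (G i) f.
Proof.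
elim: r => [|i r IHr]; last by rewrite !big_cons cformDl IHr.
by rewrite !big_nil cformE big1 // => q _; rewrite mcoeff0 !mulr0.
Qed.

Lemma cformC f g : cform f g = cform g f.
Proof. by rewrite cformE /cform; apply: eq_bigr => q _; ring. Qed.

Lemma cform_mulXU (i : 'I_(n + n)) g f :
  cform g ('X_i * f) = msign i * cform g^`M(i) f.
Proof.
rewrite [f]mpolyE; elim: (msupp f) => [|q r IHr].
  rewrite big_nil mulr0.
  by case: (cform_kernel_subspace g) => -> _;
     case: (cform_kernel_subspace g^`M(i)) => -> _; rewrite mulr0.
rewrite big_cons mulrDr -scalerAr !cformP IHr mulrDr; congr (_ + _).
rewrite mulXU_mpolyX !cform_mpolyX mnormD mcoeff_deriv -mulr_natl; ring.
Qed.

Lemma cform_mderiv (i : 'I_(n + n)) g f :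
  cform g f^`M(i) = msign i * cform ('X_i * g) f.
Proof.
by rewrite cformC [cform _ f]cformC cform_mulXU mulrA msignK mul1r cformC.
Qed.

Lemma cform_Qop k g f : cform g (Qop T k f) = cform (Pop T k g) f.
Proof.
rewrite /Qop /Pop; case: ifP => kT.
  rewrite /dx cform_mderiv msignl kT mulN1r -scaleN1r.
  by rewrite cformZl mulN1r.
by rewrite /xv cform_mulXU msignl kT mul1r.
Qed.

Lemma cform_Pop k g f : cform g (Pop T k f) = cform (Qop T k g) f.
Proof. by rewrite cformC -cform_Qop cformC. Qed.

Lemma cform_Yop k g f : cform g (Yop k f) = cform (dy k g) f.
Proof. by rewrite /Yop /yv cform_mulXU msignr mul1r. Qed.

Lemma cform_dy k g f : cform g (dy k f) = cform (Yop k g) f.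
Proof. by rewrite cformC -cform_Yop cformC. Qed.

Lemma cformB g f h : cform g (f - h) = cform g f - cform g h.
Proof. by rewrite addrC -scaleN1r cformP mulN1r addrC. Qed.

Lemma cform_Eact i j g f : cform g (Eact T j i f) = cform (Eact T i j g) f.
Proof.
rewrite !EactE cformB cform_Qop cform_Pop cform_Yop cform_dy.
by rewrite -[in RHS]scaleN1r cformDl cformZl mulN1r.
Qed.

Lemma cform_eta g f : cform g (eta T f) = cform (Delta T g) f.
Proof.
rewrite cformC etaE DeltaE !cform_suml; apply: eq_bigr => k _.
by rewrite cformC cform_Qop cform_Yop Pop_dy.
Qed.

Lemma mnorm_neq0 q : (forall k : nat, (k%:R == 0 :> K) = (k == 0%N)) ->
  mnorm q != 0.
Proof.
move=> charK; apply/prodf_neq0 => i _.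
rewrite mulf_neq0 ?charK -?lt0n ?fact_gt0 // expf_neq0 //.
apply/eqP => s0; have := msignK i; rewrite s0 mul0r => /esym/eqP.
by rewrite oner_eq0.
Qed.

(** Distinct monomials are orthogonal with nonzero squares, so it is enough to test f on its own
    monomials; the test then stays inside the bidegree of f. *)
Lemma cform_eq0 f : (forall k : nat, (k%:R == 0 :> K) = (k == 0%N)) ->
  (forall q, f@_q != 0 -> cform f 'X_[q] = 0) -> f = 0.
Proof.
move=> charK f0; apply/mpolyP => q; rewrite mcoeff0; apply/eqP.
apply/negPn/negP => fq; have /eqP := f0 _ fq.
by rewrite cform_mpolyX mulf_eq0 (negPf (mnorm_neq0 _ charK)) (negPf fq).
Qed.

End Form.

(** * Submodules and weights for the action of sl(n) *)

Section OscillatorModule.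
Variables (K : fieldType) (n : nat) (T : {set 'I_n}).
Notation B := {mpoly K[n + n]}.
Implicit Types (f g : B) (i j k : 'I_n) (q : 'X_{1..n + n}).

Lemma osc_actDl c A A' f :
  osc_act T (c *: A + A') f = c *: osc_act T A f + osc_act T A' f :> B.
Proof.
rewrite /osc_act scaler_sumr -big_split; apply: eq_bigr => i _ /=.
rewrite scaler_sumr -big_split; apply: eq_bigr => j _ /=.
by rewrite !mxE scalerDl scalerA.
Qed.

Lemma osc_act_delta i j f : osc_act T (delta_mx i j) f = Eact T i j f.
Proof.
rewrite /osc_act (bigD1 i) //= (bigD1 j) //= mxE !eqxx scale1r.
rewrite !big1 ?addr0 // => k ki; last by rewrite mxE eqxx (negPf ki) scale0r.
by rewrite big1 // => l _; rewrite mxE (negPf ki) scale0r.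
Qed.

Lemma submodule_Eact (U : B -> Prop) i j f :
  is_submodule (@osc_act K n T) U -> i != j -> U f -> U (Eact T i j f).
Proof.
move=> [_ UA] ij Uf; rewrite -osc_act_delta; apply: UA => //.
rewrite /in_sl /mxtrace big1 // => k _; rewrite mxE.
by case: (eqVneq k i) => [->|//]; rewrite (negPf ij).
Qed.

Lemma Hsp_submodule l1 l2 : is_submodule (@osc_act K n T) (@Hsp K n T l1 l2).
Proof.
have subB := @Bsp_subspace K n T l1 l2.
have subH : is_subspace (@Hsp K n T l1 l2).
  split=> [|c f g [Bf Df] [Bg Dg]].
    by split; [apply: subspace0 | rewrite linear0].
  by split; [case: subB => _; apply | rewrite linearP /= Df Dg scaler0 addr0].
split=> // A f _ [Bf Df]; rewrite /osc_act; apply: subspace_sum => // i _.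
apply: subspace_sum => // j _; apply: subspaceZ => //.
by split; [apply: Bsp_Eact | rewrite -Eact_Delta Df linear0].
Qed.

Definition Ediag q i : int :=
  (if i \in T then - (q (lshift n i))%:Z - 1 else (q (lshift n i))%:Z)
  - (q (rshift n i))%:Z.

Lemma Eact_diag_mpolyX i q : Eact T i i 'X_[q] = (Ediag q i)%:~R *: 'X_[q] :> B.
Proof.
rewrite EactE; apply/mpolyP => p.
rewrite mcoeffB mcoeffZ mcoeff_QopPop mcoeff_Yopdy mcoeffX /Ediag intrB.
by case: (eqVneq q p) => [<-|_]; rewrite ?mulr0 ?subr0 // !mulr1.
Qed.

Lemma mpolyX_has_weight (lam : 'M[K]_n -> K) q :
  (forall c h h', lam (c *: h + h') = c * lam h + lam h') ->
  (forall i j, j = i.+1 :> nat ->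
     lam (delta_mx i i - delta_mx j j) = (Ediag q i - Ediag q j)%:~R) ->
  has_weight (@osc_act K n T) lam 'X_[q].
Proof.
move=> lamP lamE h; pose W h' : Prop := osc_act T h' 'X_[q] = lam h' *: 'X_[q] :> B.
apply: (@in_span_sub _ _ W).
  have lam0 : lam 0 = 0.
    have := lamP (-1) 0 0; rewrite scaler0 add0r mulN1r addNr.
    by move=> ->.
  split=> [|c A A' IHA IHA'].
    rewrite /W lam0 scale0r /osc_act big1 // => i _; rewrite big1 // => j _.
    by rewrite mxE scale0r.
  by rewrite /W osc_actDl IHA IHA' lamP scalerDl scalerA.
move=> _ [i [j [ij ->]]]; rewrite /W (lamE _ _ ij) addrC -scaleN1r osc_actDl.
by rewrite !osc_act_delta !Eact_diag_mpolyX scaleN1r intrB scalerBl addrC.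
Qed.

End OscillatorModule.

(** * Singular vectors, generation and irreducibility *)

Section HighestWeight.
Variables (K : fieldType) (m s : nat).
Hypothesis charK : forall k : nat, (k%:R == 0 :> K) = (k == 0%N).
Notation n := m.+1.
Notation B := {mpoly K[n + n]}.
Notation T := (Tset m s).
Notation e := (@ord_max m).
Notation act := (@osc_act K n T).
Implicit Types (f g : B) (i j k : 'I_n) (q : 'X_{1..n + n}).

Hypothesis s_lt_m : (s < m)%N.
Variables (a b : 'I_n) (l1 : int) (l2 : nat).
Hypotheses (aE : a.+1 = s) (bE : b = s :> nat).
Hypothesis nonresonant :
  l1 + l2%:Z <= - (n%:Z - s%:Z - 1) \/ - (n%:Z - s%:Z - 1) < l1.
Notation H := (@Hsp K n T l1 l2%:Z).
Notation hw := (@hw_exponent m s a b l1 l2).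

Lemma dx_mpolyX k q :
  dx k 'X_[q] = (q (lshift n k))%:R *: 'X_[q - U_(lshift n k)] :> B.
Proof. by rewrite /dx mderivX. Qed.

Let ae : a != e. Proof. by rewrite -val_eqE /=; lia. Qed.
Let be : b != e. Proof. by rewrite -val_eqE /=; lia. Qed.
Let ab : a != b. Proof. by rewrite -val_eqE /=; lia. Qed.

Let aT : a \in T. Proof. exact: a_in_T aE. Qed.
Let bT : b \notin T. Proof. exact: b_notin_T bE. Qed.

(** The y-part differentiates in y_i with i < n. The x-part differentiates in an absent variable
    unless (i, j) = (a, b), when it is d/dx_a d/dx_b and one of the two exponents is 0. *)
Lemma hw_Eact q i j : hw q -> (i < j)%N -> Eact T i j 'X_[q] = 0 :> B.
Proof.
move=> [_ _ qy qx qab] lt_ij; have ie : i != e.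
  by rewrite -val_eqE /=; have := ltn_ord j; lia.
rewrite EactE dy_mpolyX qy // scale0r linear0 subr0.
have q_x k : k != a -> k != b -> dx k 'X_[q] = 0 :> B.
  by move=> ka kb; rewrite dx_mpolyX qx // scale0r.
rewrite /Qop /Pop !in_Tset; case: (ltnP j s) => js.
  have is_ : (i < s)%N by lia.
  have ij : i != j by rewrite -val_eqE /=; lia.
  rewrite is_ dxN dxM (negPf ij) scale0r addr0.
  by rewrite q_x ?mulr0 ?oppr0 // -val_eqE /=; lia.
case: (eqVneq j b) => [jb|jb]; last first.
  rewrite q_x //; last by rewrite -val_eqE /=; lia.
  by case: ifP => _; rewrite ?mulr0 // /dx linear0.
rewrite jb in lt_ij *; have is_ : (i < s)%N by lia.
rewrite is_; case: (eqVneq i a) => [->|ia]; last first.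
  by rewrite dxC q_x ?/dx ?linear0 // -val_eqE /=; lia.
case: qab => [qa|qb]; last by rewrite (dx_mpolyX b) qb scale0r /dx linear0.
by rewrite dxC dx_mpolyX qa scale0r /dx linear0.
Qed.

Lemma hw_Hsp q : hw q -> H 'X_[q].
Proof.
move=> [qX qY qy qx _]; split; first exact: Bsp_mpolyX.
rewrite DeltaE big1 // => k _; case: (eqVneq k e) => [->|ke].
  rewrite Pop_dy /Pop (negPf (e_notin_T s_lt_m)) dx_mpolyX qx ?scale0r ?linear0 //.
  - by rewrite eq_sym.
  - by rewrite eq_sym.
by rewrite dy_mpolyX qy // scale0r linear0.
Qed.

Lemma hw_unique q q' : hw q -> hw q' -> q = q'.
Proof.
have hw_val p : hw p -> [/\ (p (lshift n b))%:Z - (p (lshift n a))%:Z = l1,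
    p (rshift n e) = l2 & p (lshift n a) = 0%N \/ p (lshift n b) = 0%N].
  move=> [pX pY py px pab]; split=> //.
    rewrite -pX wt_wX (bigD1 b) //= big1 => [|k /andP[kT kb]]; last first.
      by rewrite px //; apply: contraNneq kT => ->.
    rewrite addr0 (bigD1 a) //= big1 => [|k /andP[kT ka]]; last first.
      by rewrite px //; apply: contraTneq kT => ->.
    by rewrite addr0.
  apply/eqP; rewrite -eqz_nat -pY wt_wY (bigD1 e) //= big1 ?addr0 // => k ke.
  by rewrite py.
move=> hq hq'; have [qx qe qab] := hw_val _ hq; have [qx' qe' qab'] := hw_val _ hq'.
case: hq hq' => _ _ qy0 qx0 _ [_ _ qy0' qx0' _].
apply/mnmP => i; rewrite -(splitK i); case: (split i) => k /=; last first.
  by case: (eqVneq k e) => [->|ke]; rewrite ?qe ?qe' // qy0 ?qy0'.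
case: (eqVneq k a) => [->|ka]; first by case: qab qab' => [q0|q0] [q0'|q0']; lia.
case: (eqVneq k b) => [->|kb]; first by case: qab qab' => [q0|q0] [q0'|q0']; lia.
by rewrite qx0 ?qx0'.
Qed.

Variable q0 : 'X_{1..n + n}.
Hypothesis hw_q0 : hw q0.
Notation v := ('X_[q0] : B).

Let span_v W := @lowering_span K m s charK s_lt_m a b l1 l2 aE bE nonresonant W.

(* h := g - g_(q0) v is orthogonal to v, to the image of [eta] (the adjoint of
   [Delta]) and to the images of the lowering operators (the adjoints of the
   raising ones), hence to everything. *)
Lemma singular_unique g : H g -> (forall i j, (i < j)%N -> Eact T i j g = 0) ->
  exists c, g = c *: v.
Proof.
move=> [Bg Dg] Eg; exists (g@_q0); apply/eqP; rewrite -subr_eq0; apply/eqP.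
set h := g - _.
have [Bv Dv] := hw_Hsp hw_q0.
have Bh : Bsp T l1 l2%:Z h.
  apply: (subspaceB (@Bsp_subspace K n T l1 l2%:Z)) => //.
  by apply: subspaceZ => //; apply: Bsp_subspace.
have cform_h : forall f, Bsp T l1 l2%:Z f -> cform T h f = 0.
  apply: span_v; first exact: cform_kernel_subspace.
  - move=> i j f lt_ij _; rewrite cform_Eact linearB linearZ /= Eg //.
    rewrite hw_Eact // scaler0 subr0.
    by case: (cform_kernel_subspace T f) => f0 _; rewrite cformC.
  - move=> f _; rewrite cform_eta linearB linearZ /= Dg Dv scaler0 subr0.
    by case: (cform_kernel_subspace T f) => f0 _; rewrite cformC.
  - move=> q /hw_unique /(_ hw_q0) ->; rewrite cform_mpolyX /h mcoeffB mcoeffZ.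
    by rewrite mcoeffX eqxx mulr1 subrr mulr0.
apply: (cform_eq0 (T := T) charK) => q hq; apply: cform_h.
by case/BspP: Bh => hX hY; apply: Bsp_mpolyX; [apply: hX | apply: hY].
Qed.

Let nondegenerate (k : nat) : (k < l2)%N ->
  l1 + l2%:Z + n%:Z - #|T|%:Z != k%:Z + 2.
Proof.
rewrite card_Tset //; apply: contraTneq => def_k.
(* l1 + l2 + n - s is at most 1 in the first case and at least l2 + 2 in the second, whereas k + 2
   lies strictly between. *)
by case: nonresonant; lia.
Qed.

(** The sum W of the intersection of U with H and of the image of eta satisfies the hypotheses of
    [lowering_span], so it is all of B_(l1,l2). For f in H the eta-component is again in H, hence 0
    by directness. *)
Lemma Hsp_generated (U : B -> Prop) : is_submodule act U -> U v ->
  forall f, H f -> U f.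
Proof.
move=> subU Uv; pose etaB f := exists2 g, Bsp T (l1 - 1) (l2%:Z - 1) g & f = eta T g.
have subH := @Hsp_submodule K n T l1 l2%:Z.
have subE : is_subspace etaB by apply: etaB_subspace.
pose W f := exists g h, [/\ U g /\ H g, etaB h & f = g + h].
have subW : is_subspace W.
  split=> [|c _ _ [g [h [[Ug Hg] Eh ->]]] [g' [h' [[Ug' Hg'] Eh' ->]]]].
    exists 0, 0; rewrite addr0; split=> //; last by case: subE.
    by split; [case: subU => [[]] | case: subH => [[]]].
  exists (c *: g + g'), (c *: h + h'); split.
  - by case: subU subH => [[_ UP] _] [[_ HP] _]; split; [apply: UP | apply: HP].
  - by case: subE => _; apply.
  - by rewrite scalerDr addrACA.
have BW : forall f, Bsp T l1 l2%:Z f -> W f.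
  apply: span_v => //.
  - move=> i j _ lt_ij [g [h [[Ug Hg] [h' Bh' ->] ->]]].
    have ji : j != i by rewrite -val_eqE /= neq_ltn lt_ij orbT.
    exists (Eact T j i g), (Eact T j i (eta T h')); split; last exact: linearD.
      by split; apply: submodule_Eact.
    by exists (Eact T j i h'); [apply: Bsp_Eact | apply: Eact_eta].
  - move=> g Bg; exists 0, (eta T g); rewrite add0r; split=> //; last by exists g.
    by split; [case: subU => [[]] | case: subH => [[]]].
  - move=> q hw_q; rewrite (hw_unique hw_q hw_q0); exists v, 0; rewrite addr0.
    by split=> //; [split=> //; apply: hw_Hsp | case: subE].
move=> f Hf; have [g [h [[Ug Hg] Eh def_f]]] := BW _ Hf.1.
have [_ H_etaB] := Bsp_direct_sum charK nondegenerate.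
suff h0 : h = 0 by rewrite def_f h0 addr0.
apply: H_etaB => //; have -> : h = f - g by rewrite def_f addrC addKr.
by apply: (subspaceB subH.1).
Qed.

(** Raising operators strictly decrease the height, which is bounded below; applying them to f as
    long as the result is nonzero ends at a singular vector of U, a nonzero multiple of v. *)
Lemma submodule_has_hw (U : B -> Prop) : is_submodule act U ->
  (forall f, U f -> H f) -> forall f, U f -> f <> 0 -> U v.
Proof.
move=> subU UH.
have U_bounded (N : nat) : forall f, wt_in (wH s) (fun d => d < N%:Z) f ->
    U f -> f <> 0 -> U v.
  elim: N => [|N IHN] f f_lt Uf f0; first by case: f0; apply: wH_lt0 f_lt.
  have [/existsP[i /existsP[j /andP[lt_ij Ef]]] | Ef0] :=
    boolP [exists i : 'I_n, exists j : 'I_n, (i < j)%N && (Eact T i j f != 0)].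
    apply: (IHN (Eact T i j f)); last exact/eqP.
      by apply: wt_in_Eact f_lt => [|d]; rewrite /hx /hy; lia.
    by apply: submodule_Eact => //; rewrite -val_eqE /= neq_ltn lt_ij.
  have Ef i j : (i < j)%N -> Eact T i j f = 0.
    move=> lt_ij; apply/eqP; apply: contraNT Ef0 => Ef.
    by apply/existsP; exists i; apply/existsP; exists j; rewrite lt_ij.
  have [c def_f] := singular_unique (UH _ Uf) Ef.
  have c0 : c != 0 by apply/eqP => c0; apply: f0; rewrite def_f c0 scale0r.
  by apply: (subspace_cancelZ subU.1 c0); rewrite -def_f.
move=> f Uf f0; pose N := \max_(q <- msupp f) `|wt (wH s) q|%N.
apply: (U_bounded N.+1 f) => // q; rewrite -mcoeff_msupp => fq.
have : (`|wt (wH s) q| <= N)%N by apply: leq_bigmax_seq.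
by have := wH_ge0 s q; lia.
Qed.

Lemma mpolyX_neq0 q : 'X_[q] <> 0 :> B.
Proof.
move/(congr1 (mcoeff q))/eqP; rewrite mcoeffX mcoeff0 eqxx.
by rewrite (negPf (oner_neq0 _)).
Qed.

Lemma Hsp_irreducible : irreducible_module act H.
Proof.
split; first exact: Hsp_submodule.
  by exists v; [apply: hw_Hsp | apply: mpolyX_neq0].
move=> U subU UH.
have [U0|/boolp.existsNP[f /boolp.not_implyP[Uf f0]]] :=
  boolp.pselect (forall f, U f -> f = 0); first by left.
by right=> g; apply: Hsp_generated => //; apply: submodule_has_hw f0.
Qed.

Lemma Hsp_generated_by : generated_by act H v.
Proof.
split; [exact: Hsp_submodule | exact: hw_Hsp | exact: Hsp_generated].
Qed.

Lemma hw_highest_weight (lam : 'M[K]_n -> K) :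
  has_weight act lam v -> has_highest_weight act H lam v.
Proof.
move=> v_lam; split=> //; last exact: Hsp_generated_by.
split; [exact: mpolyX_neq0 | by move=> h /v_lam; exists (lam h) | ].
pose W A : Prop := act A v = 0.
move=> A; apply: (@in_span_sub _ _ W) => [|_ [i [j [lt_ij ->]]]]; last first.
  by rewrite /W osc_act_delta hw_Eact.
split=> [|c A1 A2 WA1 WA2]; last by rewrite /W osc_actDl WA1 WA2 scaler0 addr0.
by rewrite /W /osc_act big1 // => i _; rewrite big1 // => j _; rewrite mxE scale0r.
Qed.

End HighestWeight.

(** * The explicit basis of harmonic polynomials *)

(** The shift misses the r with r_k = 0 and overshoots into degree D; the two hypotheses make
    exactly these terms vanish. *)
Lemma sum_bmnm_shift (V : nmodType) (m D : nat) (k : 'I_m)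
    (G : 'X_{1..m} -> V) :
  (forall r : 'X_{1..m}, r k = 0%N -> G r = 0) ->
  (forall r, (D <= mdeg r)%N -> G r = 0) ->
  \sum_(r : 'X_{1..m < D}) G (r + U_(k))%MM = \sum_(r : 'X_{1..m < D}) G r.
Proof.
move=> G_k G_D; pose E : seq 'X_{1..m} := [seq val r | r : 'X_{1..m < D}].
have memE r : (r \in E) = (mdeg r < D)%N.
  apply/imageP/idP => [[[r' r_lt] _ ->]|r_lt] //.
  by exists (BMultinom r_lt).
have uniqE : uniq E by rewrite map_inj_uniq ?enum_uniq //; apply: val_inj.
have sumE F : \sum_(r : 'X_{1..m < D}) F (val r) = \sum_(r <- E) F r :> V.
  by rewrite big_image.
rewrite (sumE (fun r => G (r + U_(k))%MM)) (sumE G).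
rewrite (bigID (fun r : 'X_{1..m} => (mdeg r).+1 < D)%N) /=.
rewrite [X in _ + X]big1 ?addr0 => [|r]; last first.
  by rewrite -leqNgt => r_ge; apply: G_D; rewrite mdegD mdeg1 addn1.
rewrite [RHS](bigID (fun r : 'X_{1..m} => r k != 0%N)) /=.
rewrite [X in _ = _ + X]big1 ?addr0 => [|r /negPn/eqP/G_k //].
rewrite -big_filter -(big_map (fun r => r + U_(k))%MM xpredT G) -[RHS]big_filter.
apply: perm_big; apply: uniq_perm => [||r].
- rewrite map_inj_uniq ?filter_uniq //; exact: addIm.
- exact: filter_uniq.
rewrite mem_filter memE; apply/mapP/andP => [[r' + ->]|[rk r_lt]].
  rewrite mem_filter memE => /andP[r_lt _].
  by rewrite mnmDE mnm1E eqxx addn1 mdegD mdeg1 addn1.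
have def_r : (r - U_(k) + U_(k))%MM = r by rewrite submK // lep1mP.
have mdeg_r : (mdeg (r - U_(k))).+1 = mdeg r.
  by rewrite -[in RHS]def_r mdegD mdeg1 addn1.
by exists (r - U_(k))%MM; rewrite // mem_filter memE mdeg_r r_lt ltnW // mdeg_r.
Qed.

Section HarmonicPolynomials.
Variables (K : fieldType) (m s : nat).
Hypothesis charK : forall k : nat, (k%:R == 0 :> K) = (k == 0%N).
Hypothesis s_le_m : (s <= m)%N.
Notation n := m.+1.
Notation B := {mpoly K[n + n]}.
Notation T := (Tset m s).
Notation e := (@ord_max m).
Implicit Types (f g : B) (q : 'X_{1..n + n}) (a b : 'X_{1..n}) (r : 'X_{1..m}).

Lemma ix_neq_max (k : 'I_m) : (ix k == e) = false.
Proof. by apply/negbTE; rewrite -val_eqE /= neq_ltn ltn_ord. Qed.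

Lemma max_neq_ix (k : 'I_m) : (e == ix k) = false.
Proof. by rewrite eq_sym ix_neq_max. Qed.

Lemma ix_inj : injective (@ix m).
Proof. by move=> i j /(congr1 val) /= /val_inj. Qed.

Lemma eq_ix (i j : 'I_m) : (ix i == ix j) = (i == j).
Proof. by apply/eqP/eqP => [/ix_inj|->]. Qed.

(** [insub] separates the last index, which has no coordinate in r, from the indices embedded by
    [ix]. *)
Definition hexp_x a r : 'X_{1..n} := [multinom
  if insub (i : nat) : option 'I_m is Some k
  then (if (k < s)%N then a i + r k else a i - r k)%N else (a i + mdeg r)%N
  | i < n].
Definition hexp_y b r : 'X_{1..n} := [multinom
  if insub (i : nat) : option 'I_m is Some k
  then (b i - r k)%N else (b i + mdeg r)%N | i < n].
Definition hexp a b r := mnm_pair (hexp_x a r) (hexp_y b r).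

Lemma insub_ix (k : 'I_m) : insub (ix k : nat) = Some k.
Proof. by rewrite insubT //= => k_lt; congr Some; apply: val_inj. Qed.

Lemma insub_max : insub (e : nat) = None :> option 'I_m.
Proof. by rewrite insubF //= ltnn. Qed.

Lemma hexp_x_ix a b r (k : 'I_m) : hexp a b r (lshift n (ix k)) =
  if (k < s)%N then (a (ix k) + r k)%N else (a (ix k) - r k)%N.
Proof. by rewrite mnm_pairl mnmE insub_ix. Qed.

Lemma hexp_x_max a b r : hexp a b r (lshift n e) = (a e + mdeg r)%N.
Proof. by rewrite mnm_pairl mnmE insub_max. Qed.

Lemma hexp_y_ix a b r (k : 'I_m) : hexp a b r (rshift n (ix k)) = (b (ix k) - r k)%N.
Proof. by rewrite mnm_pairr mnmE insub_ix. Qed.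

Lemma hexp_y_max a b r : hexp a b r (rshift n e) = (b e + mdeg r)%N.
Proof. by rewrite mnm_pairr mnmE insub_max. Qed.

Lemma ixP (P : 'I_n -> Prop) : (forall k, P (ix k)) -> P e -> forall i, P i.
Proof.
move=> Pix Pe i; have [->//|ie] := eqVneq i e.
have i_lt : (i < m)%N by rewrite ltn_neqAle ie -ltnS ltn_ord.
by have -> : i = ix (Ordinal i_lt) by apply: val_inj.
Qed.

Lemma mnm_pairP q q' : (forall i : 'I_n, q (lshift n i) = q' (lshift n i)) ->
  (forall i : 'I_n, q (rshift n i) = q' (rshift n i)) -> q = q'.
Proof.
by move=> qx qy; apply/mnmP => i; rewrite -(splitK i); case: (split i) => k /=.
Qed.

Lemma hterm_monE a b r : hterm_mon K s a b r = 'X_[hexp a b r].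
Proof.
rewrite -xymonE /xymon big_ord_recr [in RHS]big_ord_recr /=.
rewrite (bigID (fun i : 'I_m => (i < s)%N)) /= /hterm_mon.
rewrite !mnmE insub_max -!mulrA; congr (_ * _).
  by apply: eq_bigr => i i_s; rewrite -[widen_ord _ i]/(ix i) mnmE insub_ix i_s.
congr (_ * _).
  apply: eq_big => [i|i i_s]; first by rewrite -leqNgt.
  by rewrite -[widen_ord _ i]/(ix i) mnmE insub_ix ltnNge i_s.
rewrite [RHS]mulrCA; congr (_ * _).
by apply: eq_bigr => i _; rewrite -[widen_ord _ i]/(ix i) mnmE insub_ix.
Qed.

(** Only the factor at k changes with the shift. The ratio d / c is cross-multiplied to stay in nat,
    and the conditionals cover a k outside the range of the product. *)
Lemma prod_mnmS (P : pred 'I_m) (F : 'I_m -> nat -> nat) r k (c d : nat) :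
  (F k (r k).+1 * c = F k (r k) * d)%N ->
  ((\prod_(j | P j) F j ((r + U_(k))%MM j)) * (if P k then c else 1) =
   (\prod_(j | P j) F j (r j)) * (if P k then d else 1))%N.
Proof.
move=> Fk; have other (j : 'I_m) : j != k -> F j ((r + U_(k))%MM j) = F j (r j).
  by move=> jk; rewrite mnmDE mnm1E eq_sym (negPf jk) addn0.
case: ifPn => Pk; last first.
  congr (_ * _)%N; apply: eq_bigr => j Pj; apply: other.
  by apply: contraNneq Pk => <-.
rewrite (bigD1 k) //= [in RHS](bigD1 k) //= mnmDE mnm1E eqxx addn1.
rewrite mulnAC Fk [RHS]mulnAC; congr (_ * _)%N.
by apply: eq_bigr => j /andP[_ jk]; apply: other.
Qed.

(** This is the recursion that harmonicity imposes on the coefficients. Each binomial contributes a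
    ratio (N - r_k) / (r_k + 1); for k in S there are two of them, but the factor r_k! absorbs one
    denominator, so a single r_k + 1 remains in both cases. *)
Lemma hterm_coefS a b r (k : 'I_m) :
  (mdeg r).+1%:R *
    (if (k < s)%N then - (b (ix k) - r k)%N%:R
     else ((a (ix k) - r k) * (b (ix k) - r k))%N%:R) * hterm_coef K s a b r =
  - ((r k).+1 * (a e + mdeg r).+1 * (b e + mdeg r).+1)%N%:R
    * hterm_coef K s a b (r + U_(k)).
Proof.
have binS N j : ('C(N, j.+1) * j.+1 = 'C(N, j) * (N - j))%N.
  by rewrite mulnC mul_bin_left mulnC.
have sgn : (\sum_(j < m | (s <= j)%N) (r + U_(k))%MM j =
    \sum_(j < m | (s <= j)%N) r j + (s <= k)%N)%N.
  rewrite (eq_bigr (fun j => r j + (k == j))%N) => [|j _]; last first.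
    by rewrite mnmDE mnm1E.
  rewrite big_split /=; congr (_ + _)%N.
  case: (leqP s k) => ks.
    by rewrite (bigD1 k) //= eqxx big1 // => j /andP[_ /negPf jk]; rewrite eq_sym jk.
  by rewrite big1 // => j sj; case: (eqVneq k j) => // kj;
     rewrite -kj leqNgt ks in sj.
have := @prod_mnmS xpredT (fun j => binomial (b (ix j))) r k _ _ (binS _ _).
have := @prod_mnmS (fun j => s <= j)%N (fun j => binomial (a (ix j))) r k _ _
  (binS _ _).
have factK t : (t.+1`! * 1 = t`! * t.+1)%N by rewrite muln1 factS mulnC.
have := @prod_mnmS (fun j => s <= j)%N (fun _ => factorial) r k _ _ (factK _).
rewrite /hterm_coef sgn mdegD mdeg1 addn1 !addnS !factS.
(* The products, and later the factorials, become opaque so that [field] faces a plain rational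
   identity. *)
move: (\prod_(j < m | (s <= j)%N) 'C(a (ix j), (r + U_(k))%MM j))%N => CA'.
move: (\prod_(j < m | (s <= j)%N) 'C(a (ix j), r j))%N => CA.
move: (\prod_(j < m) 'C(b (ix j), (r + U_(k))%MM j))%N => CB'.
move: (\prod_(j < m) 'C(b (ix j), r j))%N => CB.
move: (\prod_(j < m | (s <= j)%N) ((r + U_(k))%MM j)`!)%N => FA'.
move: (\prod_(j < m | (s <= j)%N) (r j)`!)%N => FA.
move=> eFA eCA eCB.
have natK (x y : nat) : x = y -> x%:R = y%:R :> K by move=> ->.
have fact_neq0 x : x`!%:R != 0 :> K by rewrite charK -lt0n fact_gt0.
have succ_neq0 x : x.+1%:R != 0 :> K by rewrite charK.
have := fact_neq0 (a e + mdeg r)%N; have := fact_neq0 (b e + mdeg r)%N.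
have := succ_neq0 (a e + mdeg r)%N; have := succ_neq0 (b e + mdeg r)%N.
rewrite exprD !natrM; move: (_ ^+ (\sum_(j < m | _) _)) eFA eCA (natK _ _ eCB).
move=> {eCB} sg.
rewrite !natrM; move: (r k).+1 (a (ix k) - r k)%N (b (ix k) - r k)%N => rk ak bk.
move: (a e + mdeg r).+1 (b e + mdeg r).+1 => A' B'.
move: (a e + mdeg r)`! (b e + mdeg r)`! => DA DB.
rewrite ltnNge; case: (leqP s k) => ks /=; rewrite ?muln1 => -> eCA eCB.
  move: (natK _ _ eCA); rewrite !natrM => {}eCA nzB nzA nzb nza.
  transitivity ((CA%:R * ak%:R) * (CB%:R * bk%:R) * ((mdeg r).+1%:R * sg *
      (a e)`!%:R * (b e)`!%:R * (mdeg r)`!%:R * FA%:R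
      / (DA%:R * DB%:R))); first by ring.
  by rewrite -eCA -eCB; field; rewrite nzA nzB nza nzb.
rewrite eCA => nzB nzA nzb nza.
transitivity (- (CB%:R * bk%:R) * ((mdeg r).+1%:R * sg * CA%:R *
    (a e)`!%:R * (b e)`!%:R * (mdeg r)`!%:R * FA%:R
    / (DA%:R * DB%:R))); first by ring.
by rewrite -eCB; field; rewrite nzA nzB nza nzb.
Qed.

Lemma hterm_coef0 a b : hterm_coef K s a b 0 = 1.
Proof.
rewrite /hterm_coef mdeg0 !addn0 fact0 muln1.
rewrite !big1 => [|j _|j _|j _|j _]; rewrite ?mnm0E ?bin0 //.
by rewrite expr0 mul1r !muln1 divff // charK -lt0n muln_gt0 !fact_gt0.
Qed.

Lemma hexp0 a b : hexp a b 0 = mnm_pair a b.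
Proof.
apply: mnm_pairP; apply: ixP => [k|].
- by rewrite hexp_x_ix mnm_pairl mnm0E addn0 subn0 if_same.
- by rewrite hexp_x_max mnm_pairl mdeg0 addn0.
- by rewrite hexp_y_ix mnm_pairr mnm0E subn0.
- by rewrite hexp_y_max mnm_pairr mdeg0 addn0.
Qed.

(** Where the coefficient is nonzero the truncated subtractions in the exponents are exact, as
    homogeneity requires. *)
Lemma hterm_coef_leq a b r : hterm_coef K s a b r != 0 ->
  (forall k, r k <= b (ix k))%N /\ (forall k : 'I_m, s <= k -> r k <= a (ix k))%N.
Proof.
rewrite /hterm_coef mulf_eq0 negb_or => /andP[].
rewrite mulf_eq0 negb_or => /andP[_]; rewrite charK => nz _.
split=> [k|k sk]; rewrite leqNgt; apply: contraNN nz => lt_r.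
  by rewrite (bigD1 (P := xpredT) k) //= (bin_small lt_r) mul0n muln0 !mul0n.
rewrite (bigD1 k (P := fun j : 'I_m => s <= j)%N) //= (bin_small lt_r).
by rewrite mul0n muln0 !mul0n.
Qed.

Let eT : e \notin T. Proof. by rewrite in_Tset -leqNgt. Qed.

Lemma Bsp_hpoly l1 l2 a b : bidegree T l1 l2 a b ->
  Bsp T l1 l2 (hpoly K s a b).
Proof.
move=> /bidegreeP[abX abY]; apply: subspace_sum; first exact: Bsp_subspace.
move=> [r r_lt] _ /=; case: (eqVneq (hterm_coef K s a b r) 0) => [->|].
  by rewrite scale0r; apply: subspace0; apply: Bsp_subspace.
move=> /hterm_coef_leq[r_b r_a]; apply: subspaceZ; first exact: Bsp_subspace.
have mdeg_r : (mdeg r)%:Z = \sum_(k < m) (r k)%:Z.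
  by rewrite mdegE (big_morph Posz PoszD (erefl 0%:Z)).
rewrite hterm_monE; apply: Bsp_mpolyX.
  rewrite -abX /wX !wt_wxy; congr (_ + _).
  rewrite !big_ord_recr /= hexp_x_max mnm_pairl (negPf eT) PoszD mdeg_r.
  rewrite (eq_bigr (fun k : 'I_m => (if ix k \in T then -1 else 1)
      * (mnm_pair a b (lshift n (ix k)))%:Z - (r k)%:Z)) => [|k _].
    by rewrite sumrB !mul1r addrA [_ - _ + _]addrAC subrK.
  rewrite -[widen_ord _ k]/(ix k) hexp_x_ix mnm_pairl in_Tset /=.
  by have := r_a k; case: ltnP => sk; lia.
rewrite -abY /wY !wt_wxy; congr (_ + _).
  by rewrite !big1 // => k _ /=; rewrite oppr0 if_same mul0r.
rewrite !big_ord_recr /= hexp_y_max mnm_pairr !mul1r PoszD mdeg_r.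
rewrite (eq_bigr (fun k : 'I_m =>
    1 * (mnm_pair a b (rshift n (ix k)))%:Z - (r k)%:Z)) => [|k _].
  by rewrite sumrB addrA [_ - _ + _]addrAC subrK.
rewrite -[widen_ord _ k]/(ix k) hexp_y_ix mnm_pairr.
by have := r_b k; lia.
Qed.

Definition hterm a b r : B := hterm_coef K s a b r *: hterm_mon K s a b r.

Lemma hterm_gt a b r : (mdeg b < mdeg r)%N -> hterm a b r = 0.
Proof. by move=> /hterm_coef_eq0 r0; rewrite /hterm r0 scale0r. Qed.

(* The contribution of the last index to [Delta] at r + U_(k) is cancelled by
   the contributions of the other k at r, in the proportion (r_k + 1) : (|r| + 1). *)
Lemma Pop_dy_hterm a b r (k : 'I_m) :
  (mdeg r).+1%:R *: Pop T (ix k) (dy (ix k) (hterm a b r)) =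
  - ((r k).+1%:R *: dx e (dy e (hterm a b (r + U_(k)))) ).
Proof.
(* Both sides are multiples of this one monomial. *)
pose q := (hexp a b (r + U_(k)) - U_(rshift n e) - U_(lshift n e))%MM.
have -> : dx e (dy e (hterm a b (r + U_(k)))) =
    (hterm_coef K s a b (r + U_(k))
       * ((b e + mdeg r).+1%:R * (a e + mdeg r).+1%:R)) *: 'X_[q].
  rewrite /hterm hterm_monE /dx /dy !linearZ /= mderivX linearZ /= mderivX.
  rewrite mnmBE mnm1E eq_rlshift subn0 hexp_y_max hexp_x_max mdegD mdeg1.
  by rewrite addn1 [(b e + _)%N]addnS [(a e + _)%N]addnS !scalerA !mulrA.
have -> : Pop T (ix k) (dy (ix k) (hterm a b r)) = (hterm_coef K s a b r *
    (if (k < s)%N then - (b (ix k) - r k)%N%:R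
     else ((a (ix k) - r k) * (b (ix k) - r k))%N%:R)) *: 'X_[q].
  rewrite /hterm hterm_monE /dy !linearZ /= mderivX hexp_y_ix !linearZ /=.
  rewrite /Pop in_Tset /=; case: ltnP => ks.
    rewrite /xv mulXU_mpolyX scalerN scalerN scalerA mulrN scaleNr.
    rewrite [X in - (X *: _)]mulrC; congr (- (_ *: 'X_[_])).
    apply: mnm_pairP; apply: ixP => [j|];
      rewrite !(mnmDE, mnmBE) !mnm1E ?(eq_lshift, eq_rshift) ?eq_lrshift
        ?eq_rlshift ?eq_ix ?max_neq_ix ?ix_neq_max ?eqxx ?hexp_x_ix ?hexp_x_max
        ?hexp_y_ix ?hexp_y_max ?mdegD ?mdeg1 ?mnmDE ?mnm1E; last by lia.
    - by case: (ltnP j s) => js; case: (eqVneq k j) => kj; rewrite ?kj in ks *; lia.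
    - by lia.
    - by case: (eqVneq k j) => kj; lia.
  rewrite /dx mderivX mnmBE mnm1E eq_rlshift subn0 hexp_x_ix ltnNge ks /=.
  rewrite !scalerA natrM; congr (_ *: 'X_[_]); first by ring.
  apply: mnm_pairP; apply: ixP => [j|];
    rewrite !mnmBE !mnm1E ?(eq_lshift, eq_rshift) ?eq_lrshift
      ?eq_rlshift ?eq_ix ?max_neq_ix ?ix_neq_max ?eqxx ?hexp_x_ix ?hexp_x_max
      ?hexp_y_ix ?hexp_y_max ?mdegD ?mdeg1 ?mnmDE ?mnm1E; last by lia.
  - case: (ltnP j s) => js; case: (eqVneq k j) => kj; try lia.
    by rewrite kj leqNgt js in ks.
  - by lia.
  - by case: (eqVneq k j) => kj; lia.
rewrite !scalerA -scaleNr; congr (_ *: _).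
have := hterm_coefS a b r k; rewrite !natrM => coefS.
transitivity ((mdeg r).+1%:R * (if (k < s)%N then - (b (ix k) - r k)%N%:R
     else ((a (ix k) - r k)%N%:R * (b (ix k) - r k)%N%:R)) * hterm_coef K s a b r).
  by case: ifP => _; rewrite ?natrM; ring.
by rewrite coefS; ring.
Qed.

Lemma dx_dy_hterm0 a b : (a e * b e = 0)%N -> dx e (dy e (hterm a b 0)) = 0.
Proof.
move=> ab0; rewrite /hterm hterm_monE hexp0 /dx /dy !linearZ /= mderivX.
rewrite linearZ /= mderivX mnmBE mnm1E eq_rlshift subn0 mnm_pairl mnm_pairr.
by rewrite !scalerA -mulrA -natrM mulnC ab0 mulr0 scale0r.
Qed.

Lemma Delta_hpoly a b : (a e * b e = 0)%N -> Delta T (hpoly K s a b) = 0.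
Proof.
move=> ab0; pose D := (mdeg b).+1; pose Z r := dx e (dy e (hterm a b r)).
(* Z r is split into the shares r_k / |r|, one for each k < n. They add up to Z r if r is nonzero;
   at r = 0 they are 0 by division by zero, and Z 0 = 0 because alpha_n beta_n = 0. *)
pose G (k : 'I_m) r := ((r k)%:R / (mdeg r)%:R) *: Z r.
have Z0 r : (D <= mdeg r)%N -> Z r = 0.
  by move=> r_ge; rewrite /Z hterm_gt // /dx /dy !linear0.
have PG (k : 'I_m) : Pop T (ix k) (dy (ix k) (hpoly K s a b)) =
    - \sum_(r : 'X_{1..m < D}) G k r.
  rewrite -(@sum_bmnm_shift _ _ D k (G k)) => [|r rk|r /Z0 r0]; first last.
  - by rewrite /G r0 scaler0.
  - by rewrite /G rk mul0r scale0r.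
  rewrite (linear_sum (@dy K n (ix k))) /= (linear_sum (Pop T (ix k))) /= -sumrN.
  apply: eq_bigr => r _; apply: (scalerI (a := (mdeg r).+1%:R)).
    by rewrite charK.
  rewrite Pop_dy_hterm scalerN /G scalerA mnmDE mnm1E eqxx addn1 mdegD mdeg1 addn1.
  by rewrite mulrCA divff ?mulr1 // charK.
rewrite DeltaE big_ord_recr /=.
rewrite (eq_bigr (fun k : 'I_m => - \sum_(r : 'X_{1..m < D}) G k r)) => [|k _].
  rewrite sumrN exchange_big /Pop (negPf eT) /=.
  rewrite (linear_sum (@dy K n e)) /dx (linear_sum (mderiv (lshift n e))) /=.
  rewrite addrC -sumrB big1 // => -[r r_lt] _ /=.
  rewrite -/(hterm a b r) -[mderiv _ _]/(Z r) /G.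
  rewrite -scaler_suml -mulr_suml -natr_sum -mdegE.
  case: (eqVneq (mdeg r) 0%N) => [r0|r0].
    have -> : r = 0%MM by apply/eqP; rewrite -mdeg_eq0 r0.
    by rewrite /Z dx_dy_hterm0 // scaler0 subrr.
  by rewrite divff ?charK // scale1r subrr.
by rewrite -PG.
Qed.

Lemma Hsp_hpoly l1 l2 p : hindex s l1 l2 p -> Hsp T l1 l2 (hpoly K s p.1 p.2).
Proof. by move=> [ab0 Hab]; split; [apply: Bsp_hpoly | apply: Delta_hpoly]. Qed.

(** Every term with r nonzero is divisible by x_n y_n, so only the leading term r = 0, of
    coefficient 1, can contribute. *)
Lemma mcoeff_hpoly a b q : (q (lshift n e) * q (rshift n e) = 0)%N ->
  (hpoly K s a b)@_q = (mnm_pair a b == q)%:R.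
Proof.
move=> q0; rewrite /hpoly raddf_sum /=.
have m0_lt : (mdeg (0%MM : 'X_{1..m}) < (mdeg b).+1)%N by rewrite mdeg0.
rewrite (bigD1 (BMultinom m0_lt)) //= [X in _ + X]big1 ?addr0.
  by rewrite hterm_coef0 scale1r hterm_monE hexp0 mcoeffX.
move=> [r r_lt]; rewrite -val_eqE /= => r0.
rewrite mcoeffZ hterm_monE mcoeffX; case: eqVneq => [def_q|_]; last by rewrite mulr0.
move/eqP: q0; rewrite -def_q hexp_x_max hexp_y_max muln_eq0 !addn_eq0.
by rewrite mdeg_eq0 (negPf r0) !andbF.
Qed.

(** Induction on the exponent of x_n: the coefficient of Delta f at q / (x_n y_n) is a nonzero
    multiple of that of f at q, plus coefficients of f at monomials with a smaller exponent of
    x_n. *)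
Lemma Delta_determined f : Delta T f = 0 ->
  (forall q, (q (lshift n e) * q (rshift n e) = 0)%N -> f@_q = 0) -> f = 0.
Proof.
move=> Df f0; apply/mpolyP => q; rewrite mcoeff0.
have [t] := ubnP (q (lshift n e)); elim: t q => // t IHt q q_lt.
case: (eqVneq (q (lshift n e) * q (rshift n e))%N 0%N) => [/f0 //|].
rewrite muln_eq0 negb_or => /andP[q_xe q_ye].
pose p := (q - U_(lshift n e) - U_(rshift n e))%MM.
have def_q : (p + U_(lshift n e) + U_(rshift n e))%MM = q.
  rewrite -addmA [(U_(lshift n e) + _)%MM]addmC addmA.
  rewrite submK; first by rewrite submK // lep1mP.
  by rewrite lep1mP mnmBE mnm1E eq_lrshift subn0.
have p_lt : (p (lshift n e) < t)%N.
  rewrite mnmBE mnmBE !mnm1E eqxx eq_rlshift subn0 subn1.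
  by rewrite -ltnS prednK // lt0n.
clearbody p; have := congr1 (mcoeff p) Df.
rewrite DeltaE big_ord_recr /= mcoeffD mcoeff0.
rewrite raddf_sum big1 /= => [|k _].
  rewrite add0r /Pop (negPf eT) /dx /dy !mcoeff_deriv def_q => /eqP.
  by rewrite -mulr_natr mulf_eq0 charK orbF -mulr_natr mulf_eq0 charK orbF => /eqP.
rewrite -[widen_ord _ k]/(ix k) /Pop in_Tset /=; case: ltnP => ks.
  rewrite mcoeffN /xv mcoeff_mulXU /dy; case: ifP => _; first by rewrite oppr0.
  rewrite mcoeff_deriv IHt ?mul0rn ?oppr0 // !(mnmDE, mnmBE) !mnm1E eq_rlshift.
  by rewrite eq_lshift ix_neq_max subn0 addn0.
rewrite /dx /dy !mcoeff_deriv IHt ?mul0rn // !mnmDE !mnm1E eq_rlshift eq_lshift.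
by rewrite ix_neq_max !addn0.
Qed.

Lemma hpoly_basis l1 l2 :
  basis_family (hindex s l1 l2) (fun p => hpoly K s p.1 p.2) (Hsp T l1 l2).
Proof.
have [subH _] := @Hsp_submodule K n T l1 l2.
have mcoeff_h p q : (q (lshift n e) * q (rshift n e) = 0)%N ->
    (hpoly K s p.1 p.2)@_q = (p == (xpart q, ypart q))%:R.
  move=> q0; rewrite mcoeff_hpoly //; congr ((_ : bool)%:R).
  apply/eqP/eqP => [<-|->]; last by rewrite mnm_pairK.
  case: p => a b /=; congr (_, _); apply/mnmP => i; rewrite mnmE.
    by rewrite mnm_pairl.
  by rewrite mnm_pairr.
split=> [f|t c uniq_t t_index].
  split; last first.
    by apply: in_span_sub => // _ [p Hp ->]; apply: Hsp_hpoly.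
  move=> [Bf Df].
  pose M := [seq q : 'X_{1..n + n} <- msupp f |
    (q (lshift n e) * q (rshift n e) == 0)%N].
  have M_index q : q \in M -> hindex s l1 l2 (xpart q, ypart q).
    rewrite mem_filter mcoeff_msupp => /andP[/eqP q0 fq].
    split; first by rewrite /= !mnmE.
    apply/bidegreeP; rewrite mnm_pairK.
    by have [fX fY] := (BspP _ _ _ _).1 Bf; split; [apply: fX | apply: fY].
  (* By [mcoeff_hpoly], g has the same coefficients as f at all monomials not divisible by x_n y_n,
     and both are killed by Delta. *)
  pose g : B := \sum_(q <- M) f@_q *: hpoly K s (xpart q) (ypart q).
  suff -> : f = g.
    by apply: in_span_big => q /M_index qM; exists (xpart q, ypart q).
  apply/eqP; rewrite -subr_eq0; apply/eqP/Delta_determined => [|q q0].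
    have [_ Dg] : Hsp T l1 l2 g.
      rewrite /g big_seq; apply: subspace_sum => // q /M_index Hq.
      by apply: subspaceZ => //; apply: (Hsp_hpoly Hq).
    by rewrite linearB /= Df Dg subrr.
  rewrite mcoeffB /g raddf_sum /=.
  have coefE p : (f@_p *: hpoly K s (xpart p) (ypart p))@_q = f@_p * (p == q)%:R.
    rewrite mcoeffZ (mcoeff_h (xpart p, ypart p)) //; congr (_ * (_ : bool)%:R).
    apply/eqP/eqP => [/(congr1 (fun w => mnm_pair w.1 w.2))|-> //] /=.
    by rewrite !mnm_pairK.
  under eq_bigr do rewrite coefE.
  case: (boolP (q \in M)) => qM.
    rewrite (bigD1_seq q) ?filter_uniq ?msupp_uniq //= eqxx mulr1.
    rewrite big1 ?addr0 ?subrr //.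
    by move=> p /negPf ->; rewrite mulr0.
  rewrite big_seq big1 ?subr0 => [|p pM].
    apply/eqP; move: qM; rewrite mem_filter q0 eqxx /= mcoeff_msupp negbK.
    by [].
  case: (eqVneq p q) => [pq|_]; last by rewrite mulr0.
  by rewrite -pq pM in qM.
move=> sum0 [a b] ab_t; have [ab0 _] := t_index _ ab_t.
pose q := mnm_pair a b.
have q0 : (q (lshift n e) * q (rshift n e) = 0)%N by rewrite mnm_pairl mnm_pairr.
have := congr1 (mcoeff q) sum0; rewrite raddf_sum mcoeff0 /=.
rewrite (bigD1_seq (a, b)) //= mcoeffZ (mcoeff_hpoly _ _ q0) eqxx mulr1.
rewrite big1 ?addr0 // => p p_ab; rewrite mcoeffZ mcoeff_h //.
rewrite (negPf (_ : p != _)) ?mulr0 //; apply: contraNneq p_ab => ->.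
apply/eqP; congr (_, _); apply/mnmP => i; rewrite mnmE.
  by rewrite mnm_pairl.
by rewrite mnm_pairr.
Qed.

End HarmonicPolynomials.

(** * The highest weight monomial and its weight *)

Section HighestWeightMonomial.
Variables (K : fieldType) (m s : nat).
Notation n := m.+1.
Notation e := (@ord_max m).
Notation T := (Tset m s).
Hypothesis s_lt_m : (s < m)%N.
Variables (a b : 'I_n) (na nb l2 : nat).
Hypotheses (aE : a.+1 = s) (bE : b = s :> nat).

(** Both exponents are kept so that one weight computation serves both signs of l1; in the theorem
    one of them is 0. *)
Definition hw_mnm : 'X_{1..n + n} :=
  (U_(lshift n a) *+ na + U_(lshift n b) *+ nb + U_(rshift n e) *+ l2)%MM.

Lemma hw_mnmE :
  'X_[hw_mnm] = xv K a ^+ na * xv K b ^+ nb * yv K e ^+ l2.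
Proof. by rewrite !mpolyXD -!mpolyXn. Qed.

Lemma hw_mnm_x (i : 'I_n) :
  hw_mnm (lshift n i) = ((a == i) * na + (b == i) * nb)%N.
Proof. by rewrite !mnmDE !mulmnE !mnm1E !eq_lshift eq_rlshift mul0n addn0. Qed.

Lemma hw_mnm_y (i : 'I_n) : hw_mnm (rshift n i) = ((e == i) * l2)%N.
Proof. by rewrite !mnmDE !mulmnE !mnm1E !eq_lrshift eq_rshift. Qed.

Lemma hw_mnm_exponent : na = 0%N \/ nb = 0%N ->
  hw_exponent s a b (nb%:Z - na%:Z) l2 hw_mnm.
Proof.
move=> nab.
have aT : (a < s)%N by lia.
have ab : a != b by rewrite -val_eqE /=; lia.
split.
- rewrite wt_wX (bigD1 b) /= ?in_Tset -?leqNgt ?bE // big1 => [|i /andP[iT ib]].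
    rewrite (bigD1 a) /= ?in_Tset ?aT // big1 => [|i /andP[iT ia]].
      by rewrite !hw_mnm_x !eqxx [b == a]eq_sym (negPf ab) !mul1n !addr0 addn0.
    rewrite hw_mnm_x [a == i]eq_sym (negPf ia); case: (eqVneq b i) => // bi.
    by move: iT; rewrite in_Tset -bi; lia.
  rewrite hw_mnm_x [b == i]eq_sym (negPf ib); case: (eqVneq a i) => // ai.
  by move: iT; rewrite in_Tset -ai; lia.
- rewrite wt_wY (bigD1 e) //= big1 => [|i ie]; rewrite hw_mnm_y.
    by rewrite eqxx mul1n addr0.
  by rewrite eq_sym (negPf ie).
- by move=> i ie; rewrite hw_mnm_y eq_sym (negPf ie).
- by move=> i ia ib; rewrite hw_mnm_x eq_sym (negPf ia) eq_sym (negPf ib).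
rewrite !hw_mnm_x !eqxx [b == a]eq_sym (negPf ab) !mul1n addn0.
by [].
Qed.

(** At the junction of T and S, E_aa has eigenvalue - na - 1 and E_bb has nb apart from the y-part,
    whence the coefficient - (na + nb + 1). For s = 1 the first term is 0 for every i, in accordance
    with lambda_0 = 0. *)
Lemma Ediag_hw_mnm (i j : 'I_n) : j = i.+1 :> nat ->
  Ediag T hw_mnm i - Ediag T hw_mnm j =
  na%:Z * (s.-1 == i.+1)%:Z - (na + nb + 1)%:Z * (s == i.+1)%:Z
  + nb%:Z * (s.+1 == i.+1)%:Z + l2%:Z * (m == i.+1)%:Z.
Proof.
move=> ij; rewrite /Ediag !in_Tset !hw_mnm_x !hw_mnm_y -!val_eqE /=.
have j_lt := ltn_ord j; have i_lt := ltn_ord i.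
do 10![case: eqP => ?; try by exfalso; lia];
  by case: ltnP => ?; case: ltnP => ?; lia.
Qed.

Lemma hw_mnm_has_weight : has_weight (@osc_act K n T)
  (fun h => na%:R * fundwt s.-1 h - (na + nb + 1)%:R * fundwt s h
            + nb%:R * fundwt s.+1 h + l2%:R * fundwt m h) 'X_[hw_mnm].
Proof.
apply: mpolyX_has_weight => [c h h'|i j ij]; first by rewrite !fundwtD; ring.
rewrite !(fundwtE _ _ ij) Ediag_hw_mnm //.
by rewrite !(intrD, intrM, intrN) -!pmulrn.
Qed.

End HighestWeightMonomial.

(* n = m.+1, and R[i] is the field of complex numbers. The 1-based index k is
   the ordinal (inord k.-1). *)
Theorem theorem5p5 (R : realType) (m s : nat) (l1 : int) (l2 : nat) :
  let n := m.+1 in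
  let K : fieldType := complex R in
  let T : {set 'I_n} := Tset m s in
  let act := @osc_act K n T in
  let H := @Hsp K n T l1 l2%:Z in
  let c : int := - (n%:Z - s%:Z - 1) in
  (1 <= s)%N -> (s < n - 1)%N ->
  l1 + l2%:Z <= c \/ c < l1 ->
  [/\ direct_sum (@Bsp K n T l1 l2%:Z) H
        (fun f => exists2 g, @Bsp K n T (l1 - 1) (l2%:Z - 1) g & f = eta T g),
      irreducible_module act H /\ highest_weight_module act H,
      basis_family (@hindex m s l1 l2%:Z) (fun p => hpoly K s p.1 p.2) H,
      (l1 + l2%:Z <= c \/ (c < l1 /\ l1 <= 0)) ->
        has_highest_weight act H
          (fun h => (- l1)%:~R * fundwt s.-1 h + (l1 - 1)%:~R * fundwt s h
                    + l2%:R * fundwt (n - 1) h)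
          (xv K (inord s.-1) ^+ `|l1|%N * yv K ord_max ^+ l2) &
      0 < l1 ->
        has_highest_weight act H
          (fun h => - (l1 + 1)%:~R * fundwt s h + l1%:~R * fundwt s.+1 h
                    + l2%:R * fundwt (n - 1) h)
          (xv K (inord s) ^+ `|l1|%N * yv K ord_max ^+ l2)].
Proof.
move=> n K T act H c s_gt0 s_lt nonresonant.
have s_lt_m : (s < m)%N by rewrite subn1 in s_lt.
have charK (k : nat) : (k%:R == 0 :> K) = (k == 0%N).
  exact: (pnatr_eq0 (complex R : numDomainType)).
pose a : 'I_n := inord s.-1; pose b : 'I_n := inord s.
have aE : a.+1 = s by rewrite inordK; lia.
have bE : b = s :> nat by rewrite inordK; lia.
have hl : l1 + l2%:Z <= - (n%:Z - s%:Z - 1) \/ - (n%:Z - s%:Z - 1) < l1.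
  exact: nonresonant.
have hw_neg (k : nat) : l1 = - k%:Z -> hw_exponent s a b l1 l2 (hw_mnm a b k 0 l2).
  move=> ->; rewrite -[- _]add0r; apply: hw_mnm_exponent => //; by right.
have hw_pos (k : nat) : l1 = k%:Z -> hw_exponent s a b l1 l2 (hw_mnm a b 0 k l2).
  move=> ->; rewrite -[k%:Z]subr0; apply: hw_mnm_exponent => //; by left.
have [na [nb hw_v]] :
    exists na nb, hw_exponent s a b l1 l2 (hw_mnm a b na nb l2).
  case: (lerP l1 0) => l1_0.
    by exists `|l1|%N, 0%N; apply: hw_neg; lia.
  by exists 0%N, `|l1|%N; apply: hw_pos; lia.
have hw_lam q lam : hw_exponent s a b l1 l2 q -> has_weight act lam 'X_[q] ->
    has_highest_weight act H lam 'X_[q].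
  by move=> hw_q; apply: (hw_highest_weight charK s_lt_m aE bE hl hw_q).
split.
- apply: Bsp_direct_sum => // k lt_k.
  rewrite card_Tset //; apply: contraTneq lt_k => def_k.
  by case: hl; lia.
- split; first exact: (Hsp_irreducible charK s_lt_m aE bE hl hw_v).
  have [v_hw v_gen _] :=
    hw_lam _ _ hw_v (@hw_mnm_has_weight K m s s_lt_m a b na nb l2 aE bE).
  by exists 'X_[hw_mnm a b na nb l2].
- exact: hpoly_basis charK (ltnW s_lt_m) _ _.
(* The alternative l1 + l2 <= - (n - s - 1) also forces l1 <= 0, as l2 >= 0 and s < n - 1. *)
- move=> l1_le; have [k def_l1] : exists k : nat, l1 = - k%:Z.
    by exists `|l1|%N; rewrite /c /n in l1_le; lia.
  have -> : xv K (inord s.-1) ^+ `|l1|%N * yv K ord_max ^+ l2 =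
      'X_[hw_mnm a b k 0 l2].
    by rewrite hw_mnmE expr0 mulr1 def_l1 abszN.
  apply: hw_lam; first exact: hw_neg.
  move=> h hh; apply: etrans (@hw_mnm_has_weight K m s s_lt_m a b k 0 l2 aE bE h hh) _.
  congr (_ *: _).
  rewrite def_l1 opprK subn1 /= addn0 addn1.
  by rewrite !(intrD, intrN) -!pmulrn -natr1; ring.
move=> l1_gt0; have [k def_l1] : exists k : nat, l1 = k%:Z.
  by exists `|l1|%N; lia.
have -> : xv K (inord s) ^+ `|l1|%N * yv K ord_max ^+ l2 =
    'X_[hw_mnm a b 0 k l2].
  by rewrite hw_mnmE expr0 mul1r def_l1.
apply: hw_lam; first exact: hw_pos.
move=> h hh; apply: etrans (@hw_mnm_has_weight K m s s_lt_m a b 0 k l2 aE bE h hh) _.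
  congr (_ *: _).
rewrite def_l1 subn1 /= add0n addn1.
by rewrite !(intrD, intrN) -!pmulrn -natr1; ring.
Qed.
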